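(* Let $X=(X_i)_{i\in\mathbb{Z}^d}$ be a real-valued, mean zero, variance one, translation invariant random field with covariance $\mathbf{E}[X_iX_j]=K(i-j)$, where $(K(j))_{j\in\mathbb{Z}^d}\in\ell_1(\mathbb{Z}^d)$, such that for every finite $F\subset\mathbb{Z}^d$ the vector $(X_i)_{i\in F}$ has a joint density on $\mathbb{R}^{|F|}$. Let $\Lambda$ be a bounded connected domain in $\mathbb{R}^d$ with $2$-smooth boundary $\partial\Lambda$, each connected component of which has positive Gaussian curvature, and let $\Lambda_L=\{Lx:x\in\Lambda\}$ for $L>0$. Suppose $|\Lambda_L\cap\mathbb{Z}^d|=O(L^d)$ as $L\to\infty$. Suppose that the structure function $S(\theta)=\sum_{j\in\mathbb{Z}^d}e^{i\theta\cdot j}K(j)$, $\theta\in[-\pi,\pi]^d$, vanishes on a neighbourhood of the origin and satisfies $$\sum_{j\in\mathbb{Z}^d}|\hat S(j)|<\infty\quad\text{and}\quad\sum_{j\in\mathbb{Z}^d}\big||j|\,\hat S(j)\big|^2<\infty.$$ Then $$\lim_{L\to\infty}\frac{h(X|_{\Lambda_L})}{|\Lambda_L\cap\mathbb{Z}^d|}=-\infty.$$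
   Context: For $j\in\mathbb{Z}^d$, $|j|$ is the Euclidean norm and $\hat S(j)=\frac{1}{(2\pi)^d}\int_{[-\pi,\pi]^d}e^{-ij\cdot\theta}S(\theta)\,d\theta$ (so $\hat S(j)=K(j)$). For bounded $\Lambda\subset\mathbb{R}^d$, $X|_\Lambda=(X_i)_{i\in\Lambda\cap\mathbb{Z}^d}$, and its (differential) entropy is $h(X|_\Lambda)=-\int_{\mathbb{R}^{n}}f_\Lambda(x)\log f_\Lambda(x)\,dx$, where $n=|\Lambda\cap\mathbb{Z}^d|$ and $f_\Lambda$ is the joint density of $X|_\Lambda$. A boundary is $2$-smooth if it is locally given as a level set of a $2$-smooth function; its Gaussian curvature at a point is the product of the principal curvatures there. *)

(* Defs.v *)
From HB Require Import structures.
From mathcomp Require Import all_boot all_order all_algebra.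
From mathcomp Require Import finmap.
From mathcomp Require Import all_classical all_reals all_analysis.
From mathcomp Require Import complex.
Set Implicit Arguments.
Unset Strict Implicit.
Unset Printing Implicit Defensive.
Import Order.TTheory GRing.Theory Num.Theory.
Import numFieldNormedType.Exports.
Local Open Scope classical_set_scope.
Local Open Scope ring_scope.

(* Z^d is 'rV[int]_d and R^d is 'rV[R]_d, except that integrals over R^n use
   n.-tuple R, the type on which the library puts the product sigma-algebra. *)

Section LebesgueTuple.
Context {R : realType}.

Definition cons_pair n (p : R * n.-tuple R) : n.+1.-tuple R :=
  [tuple of p.1 :: p.2].

Lemma measurable_cons_pair n : measurable_fun setT (@cons_pair n).
Proof. exact: measurable_cons. Qed.

Definition uncons n (t : n.+1.-tuple R) : R * n.-tuple R :=
  (thead t, [tuple of behead t]).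

Lemma measurable_uncons n : measurable_fun setT (@uncons n).
Proof.
apply/measurable_fun_pairP; split.
- exact: (@measurable_tnth _ (measurableTypeR R) n.+1 ord0).
- exact: measurable_behead.
Qed.

Lemma cons_pairK n : cancel (@cons_pair n) (@uncons n).
Proof.
by case=> x t; rewrite /uncons /cons_pair theadE; congr pair; apply: val_inj.
Qed.

Section step.
Variables (n : nat) (mu : {sigma_finite_measure set (n.-tuple R) -> \bar R}).

Definition lebesgue_cons : set (n.+1.-tuple R) -> \bar R :=
  pushforward (@lebesgue_measure R \x mu)%E (@cons_pair n).

Let lebesgue_cons0 : lebesgue_cons set0 = 0%E.
Proof. by rewrite /lebesgue_cons /pushforward preimage_set0 measure0. Qed.

Let lebesgue_cons_ge0 A : (0 <= lebesgue_cons A)%E.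
Proof. exact: (measure_ge0 (@lebesgue_measure R \x mu)%E). Qed.

Let lebesgue_cons_sigma_additive : semi_sigma_additive lebesgue_cons.
Proof.
move=> F mF tF mUF; rewrite /lebesgue_cons /pushforward preimage_bigcup.
have mpre B : measurable B -> measurable (@cons_pair n @^-1` B).
  by move=> mB; rewrite -[X in measurable X]setTI; exact: measurable_cons_pair.
apply: (@measure_semi_sigma_additive _ _ _ (@lebesgue_measure R \x mu)%E).
- by move=> k; exact: mpre.
- apply/trivIsetP => /= i j _ _ ij; rewrite -preimage_setI.
  by move/trivIsetP : tF => /(_ _ _ _ _ ij) ->//; rewrite preimage_set0.
- by rewrite -preimage_bigcup; exact: mpre.
Qed.

HB.instance Definition _ := isMeasure.Build _ _ _ lebesgue_cons
  lebesgue_cons0 lebesgue_cons_ge0 lebesgue_cons_sigma_additive.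

Let lebesgue_cons_sigma_finite : sigma_finite setT lebesgue_cons.
Proof.
have /sigma_finiteP[F [TF ndF Foo]] := sigma_finiteT (@lebesgue_measure R).
have /sigma_finiteP[G [TG ndG Goo]] := sigma_finiteT mu.
exists (fun k => @uncons n @^-1` (F k `*` G k)).
  apply/esym/seteqP; split => // t _.
  have [i _ Fi] : (\bigcup_k F k) (thead t) by rewrite -TF.
  have [j _ Gj] : (\bigcup_k G k) [tuple of behead t] by rewrite -TG.
  exists (maxn i j) => //; split => /=.
  - by move: Fi; exact/subsetPset/ndF/leq_maxl.
  - by move: Gj; exact/subsetPset/ndG/leq_maxr.
move=> k; have [mF Fk] := Foo k; have [mG Gk] := Goo k.
have mFG : measurable (F k `*` G k) by exact: measurableX.
split.
  by rewrite -[X in measurable X]setTI; exact: measurable_uncons.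
rewrite /lebesgue_cons /pushforward -comp_preimage.
have -> : @uncons n \o @cons_pair n = id by apply/funext => p; exact: cons_pairK.
by rewrite preimage_id product_measure1E// lte_mul_pinfty// ge0_fin_numE.
Qed.

HB.instance Definition _ := Measure_isSigmaFinite.Build _ _ _ lebesgue_cons
  lebesgue_cons_sigma_finite.

End step.

(* Lebesgue measure on R^n, as an iterated product measure. *)
Fixpoint lebesgue_tuple n : {sigma_finite_measure set (n.-tuple R) -> \bar R} :=
  match n with
  | 0 => \d_ [tuple]
  | m.+1 => lebesgue_cons (lebesgue_tuple m)
  end.

End LebesgueTuple.

Section Entropy.
Context {R : realType} {disp : measure_display} {T : measurableType disp}.
Variable P : probability T R.

Definition is_joint_density n (Y : T -> n.-tuple R) (f : n.-tuple R -> R) :=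
  [/\ measurable_fun setT f, (forall x, 0 <= f x) &
      forall A, measurable A ->
        P (Y @^-1` A) = (\int[lebesgue_tuple n]_(x in A) (f x)%:E)%E].

Definition has_joint_density n (Y : T -> n.-tuple R) :=
  exists f, is_joint_density Y f.

(* Some density; any two agree Lebesgue-almost everywhere. *)
Definition joint_density n (Y : T -> n.-tuple R) : n.-tuple R -> R :=
  xget (cst 0) [set f | is_joint_density Y f].

(* The library's ln is 0 at 0, so the integrand is 0 where the density is. *)
Definition entropy n (Y : T -> n.-tuple R) : \bar R :=
  let f := joint_density Y in
  (- \int[lebesgue_tuple n]_x (f x * ln (f x))%:E)%E.

End Entropy.

Section RandomField.
Context {R : realType} {disp : measure_display} {T : measurableType disp}.
Variable d : nat.
Implicit Types (X : 'rV[int]_d -> T -> R) (F : {fset 'rV[int]_d}).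

(* The vector (X_i)_{i in F}, in the order in which the library enumerates F. *)
Definition field_restr X F (w : T) : (size F).-tuple R :=
  map_tuple (fun i => X i w) (in_tuple F).

Definition translation_invariant (P : probability T R) X :=
  forall (k : 'rV[int]_d) F (A : set ((size F).-tuple R)), measurable A ->
    P (field_restr (fun i => X (i + k)) F @^-1` A) =
    P (field_restr X F @^-1` A).

End RandomField.

Section Fourier.
Context {R : realType}.

(* The unordered sum of f when f is absolutely summable (else unspecified). *)
Definition real_sum (I : choiceType) (f : I -> R) : R :=
  fine (esum setT (EFin \o f)^\+ - esum setT (EFin \o f)^\-)%E.

Definition complex_sum (I : choiceType) (f : I -> R[i]) : R[i] :=
  Complex (real_sum (fun j => complex.Re (f j)))
          (real_sum (fun j => complex.Im (f j))).

Definition cis (t : R) : R[i] := Complex (cos t) (sin t).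

Variable d : nat.

Definition int_point (j : 'rV[int]_d) : 'rV[R]_d := map_mx intr j.

Definition dot (u v : 'rV[R]_d) : R := \sum_i u 0 i * v 0 i.

(* Euclidean; the norm `|_| of the library on 'rV[R]_d is the sup norm. *)
Definition enorm (u : 'rV[R]_d) : R := Num.sqrt (dot u u).

Definition structure_function (K : 'rV[int]_d -> R) (theta : 'rV[R]_d) : R[i] :=
  complex_sum (fun j => cis (dot theta (int_point j)) * (K j)%:C%C).

Definition torus : set (d.-tuple R) :=
  [set t | forall i, - pi <= tnth t i <= pi].

Definition row_of_tuple (t : d.-tuple R) : 'rV[R]_d := \row_i tnth t i.

Definition torus_integral (g : 'rV[R]_d -> R[i]) : R[i] :=
  Complex
    (\int[lebesgue_tuple d]_(t in torus) complex.Re (g (row_of_tuple t)))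
    (\int[lebesgue_tuple d]_(t in torus) complex.Im (g (row_of_tuple t))).

Definition fourier_coef (S : 'rV[R]_d -> R[i]) (j : 'rV[int]_d) : R[i] :=
  (((2 * pi) ^+ d)^-1)%:C%C *
  torus_integral (fun theta => cis (- dot (int_point j) theta) * S theta).

End Fourier.

Section Domain.
Context {R : realType}.
Variable d : nat.
Implicit Types (U Gamma Lambda : set 'rV[R]_d) (phi : 'rV[R]_d -> R^o)
  (nu p : 'rV[R]_d).

Definition boundary Lambda : set 'rV[R]_d :=
  closure Lambda `\` interior Lambda.

Definition lattice_points Lambda (L : R) : set 'rV[int]_d :=
  [set j | ([set L *: x | x in Lambda]) (int_point j)].

Definition partial (i : 'I_d) phi : 'rV[R]_d -> R^o :=
  fun x => 'D_(delta_mx 0 i) phi x.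

Definition C1_on U phi := forall i x, U x ->
  derivable phi x (delta_mx 0 i) /\ {for x, continuous (partial i phi)}.

Definition C2_on U phi := C1_on U phi /\ forall i, C1_on U (partial i phi).

Definition gradient phi p : 'rV[R]_d := \row_i partial i phi p.

Definition hessian phi p : 'M[R]_d := \matrix_(i, j) partial j (partial i phi) p.

(* Near p, Gamma is a regular level set of the C^2 function phi. *)
Definition local_level_set Gamma p U phi :=
  [/\ open U, U p, C2_on U phi, (forall x, U x -> gradient phi x != 0) &
      Gamma `&` U = [set x | U x /\ phi x = phi p]].

Definition two_smooth Gamma := forall p, Gamma p ->
  exists U phi, local_level_set Gamma p U phi.

Definition unit_normal phi p nu :=
  dot nu nu = 1 /\ exists c : R, gradient phi p = c *: nu.

(* If gamma is a curve in {phi = const} with gamma(0) = p and gamma'(0) = v then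
   differentiating phi \o gamma twice gives
     <gamma''(0), nu> = - v H v^T / <grad phi(p), nu>,   H the Hessian at p,
   for nu a unit normal at p, so this is the second fundamental form with
   respect to nu (positive definite on a sphere for the inward normal). *)
Definition second_form phi p nu (v w : 'rV[R]_d) : R :=
  - dot (v *m hessian phi p) w / dot (gradient phi p) nu.

(* The rows of E are an orthonormal basis of the tangent hyperplane made of
   principal directions, and kappa lists the principal curvatures. *)
Definition principal_curvatures phi p nu (E : 'M[R]_(d.-1, d))
    (kappa : 'rV[R]_d.-1) :=
  [/\ E *m E^T = 1%:M, (forall k, dot (row k E) nu = 0) &
      forall k l, second_form phi p nu (row k E) (row l E) =
                  kappa 0 k *+ (k == l)].

Definition has_gaussian_curvature Gamma p nu (G : R) :=
  exists U phi E kappa,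
    [/\ local_level_set Gamma p U phi, unit_normal phi p nu,
        principal_curvatures phi p nu E kappa & G = \prod_k kappa 0 k].

(* Reversing the unit normal multiplies the Gaussian curvature by (-1)^(d-1);
   each connected component may be given its own (continuous) orientation. *)
Definition components_positive_curvature Gamma :=
  forall q, Gamma q -> let C := connected_component Gamma q in
    exists N : 'rV[R]_d -> 'rV[R]_d, {within C, continuous N} /\
      forall p, C p ->
        exists G, has_gaussian_curvature Gamma p (N p) G /\ 0 < G.

Definition bounded_domain Lambda :=
  [/\ Lambda !=set0, open Lambda, connected Lambda & bounded_set Lambda].

End Domain.

(* Main.v *)
(** By Gibbs' inequality, for every Gaussian density g on R^n the entropy of a
    random vector is at most the expectation of -log g, so for W invertible
      h(Y) <= n/2 log(2 pi) - log |det W| + 1/2 sum_k E (W Y)_k^2.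
    Cut Z^d into cubic tiles of side N and let W act on each tile contained in F
    as a real orthogonal discrete Fourier (Hartley) transform followed by a
    rescaling of every frequency, and as the identity on the other sites.  The
    energy of X at frequency theta in a tile is at most twice a Fejer-type mean
    of S near theta: it is bounded by 2 |K|_1, and by 4 e for the positive
    fraction of frequencies lying in the neighbourhood of 0 where S vanishes, as
    soon as N is large.  Rescaling these by e^(-1/2) gives
      h(X|F) <= a |F| + 1/2 G log e,
    where G counts the low frequencies in the tiles contained in F.  For
    F = Lambda_L the ratio G / |F| stays above a positive constant which does not
    depend on e, because Lambda contains a cube and |F| = O(L^d); let e -> 0. *)

Require Import Defs.
From HB Require Import structures.
From mathcomp Require Import all_boot all_order all_algebra.
From mathcomp Require Import finmap.
From mathcomp Require Import all_classical all_reals all_analysis.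
From mathcomp Require Import measurable_realfun.
From mathcomp Require Import complex ring lra zify.
Set Implicit Arguments.
Unset Strict Implicit.
Unset Printing Implicit Defensive.
Import Order.TTheory GRing.Theory Num.Theory.
Import numFieldNormedType.Exports.
Local Open Scope classical_set_scope.
Local Open Scope ring_scope.

(** * Gaussian integrals of positive definite quadratic forms *)

Definition qform (R : realType) n (Q : 'M[R]_n) (v : 'rV[R]_n) : R :=
  (v *m Q *m v^T) 0 0.

Definition posdef (R : realType) n (Q : 'M[R]_n) :=
  Q^T = Q /\ forall v, v != 0 -> 0 < qform Q v.

Section GaussianIntegral.
Context {R : realType}.

Lemma integral_gauss1 (a c : R) : 0 < a ->
  (\int[lebesgue_measure]_x (expR (- (a * (x + c) ^+ 2) / 2))%:E =
   (Num.sqrt (2 * pi / a))%:E)%E.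
Proof.
move=> a0; pose s := (Num.sqrt a)^-1.
have s0 : s != 0 by rewrite invr_eq0 gt_eqF// sqrtr_gt0.
have s2 : s ^+ 2 = a^-1 by rewrite exprVn sqr_sqrtr// ltW.
have := integral_normal_pdf (- c) s.
rewrite normal_pdfE//.
have E x : normal_fun (- c) s x = expR (- (a * (x + c) ^+ 2) / 2).
  rewrite /normal_fun s2 opprK; congr expR.
  by field; rewrite gt_eqF.
under eq_integral do rewrite E EFinM.
have mE : measurable_fun setT
    (fun x : R => expR (- (a * (x + c) ^+ 2) / 2)).
  rewrite (_ : (fun x => _) = normal_fun (- c) s); last exact/esym/funext.
  exact: measurable_normal_fun.
rewrite ge0_integralZl_EFin ?normal_peak_ge0//; last exact/measurable_EFinP.
rewrite /normal_peak s2 => H.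
have p0 : 0 < a^-1 * pi *+ 2 by rewrite mulrn_wgt0// mulr_gt0 ?invr_gt0 ?pi_gt0.
set I := (\int[_]_x _)%E in H *.
have r0 : Num.sqrt (a^-1 * pi *+ 2) != 0 by rewrite gt_eqF// sqrtr_gt0.
have <- : Num.sqrt (a^-1 * pi *+ 2) = Num.sqrt (2 * pi / a).
  by congr Num.sqrt; ring.
by rewrite -[I]mul1e -[X in (X * I)%E]/(1%:E) -(mulfV r0) EFinM -muleA H mule1.
Qed.

Lemma measurable_row_of_tuple_mul n m (A : 'M[R]_(n, m)) i :
  measurable_fun setT (fun x : n.-tuple R => (row_of_tuple x *m A) 0 i).
Proof.
under eq_fun do rewrite mxE.
apply: measurable_sum => j; under eq_fun do rewrite mxE.
by apply: measurable_funM => //; exact: measurable_tnth.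
Qed.

Lemma measurable_qform n (Q : 'M[R]_n) :
  measurable_fun setT (fun x : n.-tuple R => qform Q (row_of_tuple x)).
Proof.
under eq_fun do rewrite /qform mxE.
apply: measurable_sum => j; apply: measurable_funM => //.
  exact: measurable_row_of_tuple_mul.
by under eq_fun do rewrite !mxE; exact: measurable_tnth.
Qed.

Section Schur.
Variables (n : nat) (Q : 'M[R]_(1 + n)).

Let a := Q 0 0.
Let b : 'M[R]_(1, n) := ursubmx Q.

Definition schur_compl : 'M[R]_n := drsubmx Q - a^-1 *: (b^T *m b).

Hypothesis symQ : Q^T = Q.
Hypothesis a0 : a != 0.

Lemma schur_decomp : Q =
  block_mx 1%:M 0 (a^-1 *: b^T) 1%:M *m block_mx a%:M 0 0 schur_compl *m
  block_mx 1%:M (a^-1 *: b) 0 1%:M.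
Proof.
rewrite !mulmx_block !mul1mx !mulmx1 !mulmx0 !mul0mx !addr0 !add0r.
rewrite mul_mx_scalar mul_scalar_mx -scalemxAr -?scalemxAl !scalerA divff// !scale1r.
rewrite mulVf// mul1r addrC /schur_compl subrK.
rewrite -[LHS]submxK; congr block_mx.
- apply/matrixP=> i j; rewrite !ord1 !mxE eqxx mulr1n; congr (Q _ _); exact/val_inj.
- by rewrite /b trmx_ursub symQ.
Qed.

Lemma det_schur : \det Q = a * \det schur_compl.
Proof.
rewrite schur_decomp !det_mulmx !det_lblock det_ublock !det1 !mulr1 !mul1r.
by rewrite det_scalar expr1.
Qed.

(** Completing the square in the first coordinate: [t] enters only through the square, and the
    remaining form in [w] has the Schur complement as its matrix. *)
Lemma qform_schur (t : R) (w : 'rV[R]_n) :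
  qform Q (row_mx t%:M w) =
  a * (t + a^-1 * (b *m w^T) 0 0) ^+ 2 + qform schur_compl w.
Proof.
rewrite /qform {1}schur_decomp.
rewrite !mulmxA mul_row_block mulmx0 mulmx1 add0r.
rewrite tr_row_mx -!mulmxA mul_block_col !mul1mx mul0mx !add0r mul_block_col.
rewrite !mul0mx addr0 add0r mul_row_col mxE mulmxA; congr (_ + _).
  rewrite -scalemxAl -scalemxAr tr_scalar_mx.
  have -> : w *m b^T = ((b *m w^T) 0 0)%:M.
    by rewrite -[LHS]trmxK trmx_mul trmxK [X in X^T]mx11_scalar tr_scalar_mx.
  rewrite [X in _ *m (_ + _ *: X)]mx11_scalar !scale_scalar_mx.
  by rewrite -!raddfD/= -!scalar_mxM !mxE eqxx !mulr1n; ring.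
by rewrite mulmx1 mulmxA.
Qed.

End Schur.

Lemma posdef_corner_gt0 n (Q : 'M[R]_(1 + n)) : posdef Q -> 0 < Q 0 0.
Proof.
case=> _ /(_ (delta_mx 0 0)).
rewrite /qform -rowE mxE (bigD1 0)//= big1 ?addr0; last first.
  by move=> i i0; rewrite !mxE/= (negbTE i0) mulr0.
rewrite !mxE !eqxx mulr1; apply.
by apply/eqP => /matrixP/(_ 0 0); rewrite !mxE !eqxx => /eqP; rewrite oner_eq0.
Qed.

Lemma posdef_schur_compl n (Q : 'M[R]_(1 + n)) :
  posdef Q -> posdef (schur_compl Q).
Proof.
move=> pQ; have a0 := posdef_corner_gt0 pQ; case: pQ => sQ pQ; split.
  rewrite /schur_compl linearB linearZ/= trmx_mul trmxK.
  by rewrite trmx_drsub sQ.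
move=> w w0.
set c := (ursubmx Q *m w^T) 0 0.
(* The first coordinate is chosen to make the completed square vanish, which leaves the form of the
   Schur complement alone. *)
have := pQ (row_mx (- ((Q 0 0)^-1 * c))%:M w).
rewrite qform_schur// ?gt_eqF// addNr expr0n mulr0 add0r; apply.
by apply: contra w0 => /eqP; rewrite -row_mx0 => /eq_row_mx[_ ->].
Qed.

(** [lebesgue_tuple] pushes a product measure forward along [cons_pair], so this is Tonelli's
    theorem with the first coordinate innermost. *)
Lemma integral_lebesgue_tupleS n (f : n.+1.-tuple R -> \bar R) :
  measurable_fun setT f -> (forall x, 0 <= f x)%E ->
  (\int[lebesgue_tuple n.+1]_x f x =
   \int[lebesgue_tuple n]_y \int[lebesgue_measure]_t f (cons_pair (t, y)))%E.
Proof.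
move=> mf f0.
have mc : @measurable_fun _ _ (measurableTypeR R * n.-tuple R)%type
  (n.+1.-tuple R) setT (@cons_pair R n) by exact: measurable_cons_pair.
have mfc : measurable_fun setT (f \o @cons_pair R n) by exact: measurableT_comp.
have := @fubini_tonelli2 _ _ _ _ R lebesgue_measure (lebesgue_tuple n)
  _ mfc (fun x => f0 _).
rewrite /fubini_G => <-.
pose mu := (@lebesgue_measure R \x lebesgue_tuple n)%E
  : {measure set (measurableTypeR R * n.-tuple R) -> \bar R}.
by have := @ge0_integral_pushforward _ _ _ _ R _ mc mu setT f measurableT mf
  (fun x _ => f0 x); rewrite preimage_setT => <-.
Qed.

Lemma row_of_tuple_cons n (t : R) (y : n.-tuple R) :
  row_of_tuple (cons_pair (t, y)) = row_mx t%:M (row_of_tuple y) :> 'rV[R]_(1 + n).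
Proof.
apply/rowP => i; rewrite -(splitK i); case: (fintype.split i) => j /=.
  by rewrite row_mxEl ord1 !mxE eqxx mulr1n.
rewrite row_mxEr !mxE (_ : rshift 1 j = lift ord0 j) ?tnthS; last exact/val_inj.
by congr tnth; exact/val_inj.
Qed.

(** Induction on [n]: once the square is completed, integrating out the first coordinate gives the
    factor [2 * pi / Q 0 0] under the root and leaves the Schur complement. The determinant factors
    in the same way, so its positivity comes from the same induction. *)
Lemma integral_gauss n (Q : 'M[R]_n) : posdef Q ->
  0 < \det Q /\
  (\int[lebesgue_tuple n]_x (expR (- qform Q (row_of_tuple x) / 2))%:E =
   (Num.sqrt ((2 * pi) ^+ n / \det Q))%:E)%E.
Proof.
have mq m (A : 'M[R]_m) : measurable_fun setT
    (fun x : m.-tuple R => expR (- qform A (row_of_tuple x) / 2)).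
  apply: measurableT_comp => //.
  apply: measurable_funM => //; apply: measurableT_comp => //.
  exact: measurable_qform.
elim: n Q => [|n IH] Q pQ.
  rewrite det_mx00; split => //; rewrite integral_dirac//; last first.
    by have /measurable_EFinP := mq _ Q.
  rewrite [X in (X * _)%E](_ : _ = 1%E); last exact: diracT.
  by rewrite mul1e /qform mxE big_ord0 oppr0 mul0r expR0 expr0 divr1 sqrtr1.
have a0 := posdef_corner_gt0 pQ.
have [d0 IHQ] := IH _ (posdef_schur_compl pQ).
have [sQ _] := pQ.
have a_neq0 : Q 0 0 != 0 by rewrite gt_eqF.
rewrite (det_schur sQ a_neq0); split; first by rewrite mulr_gt0.
rewrite integral_lebesgue_tupleS//; last by have /measurable_EFinP := mq _ Q.
have E (y : n.-tuple R) :
   (\int[lebesgue_measure]_t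
     (expR (- qform Q (row_of_tuple (cons_pair (t, y))) / 2))%:E =
   (Num.sqrt (2 * pi / Q 0 0))%:E *
     (expR (- qform (schur_compl Q) (row_of_tuple y) / 2))%:E)%E.
  rewrite -(integral_gauss1
    ((Q 0 0)^-1 * (ursubmx (Q : 'M[R]_(1 + n)) *m (row_of_tuple y)^T) 0 0) a0).
  rewrite -ge0_integralZr//; last first.
    apply/measurable_EFinP; apply: measurableT_comp => //.
    apply: measurable_funM => //; apply: measurableT_comp => //.
    apply: measurable_funM => //; apply: measurable_funX => //.
    exact: measurable_funD.
  apply: eq_integral => t _; rewrite row_of_tuple_cons (qform_schur sQ a_neq0).
  by rewrite -EFinM -expRD opprD mulrDl.
under eq_integral do rewrite E.
rewrite ge0_integralZl_EFin//; last first.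
  by have /measurable_EFinP := mq _ (schur_compl (Q : 'M[R]_(1 + n))).
rewrite [X in (_ * X)%E]IHQ -EFinM -sqrtrM; last first.
  by rewrite divr_ge0 ?mulr_ge0 ?pi_ge0// ltW.
congr (Num.sqrt _)%:E; rewrite exprS; field.
by rewrite a_neq0 gt_eqF.
Qed.

End GaussianIntegral.

(** * Gibbs' inequality and the Gaussian bound on entropy *)

Section EntropyBound.
Context {R : realType} {disp : measure_display} {T : measurableType disp}.
Variable P : probability T R.

(** The positive part of [h] is below that of [f] and the negative part above; this compares the
    integrals even when they are infinite. *)
Lemma le_integral_ge d (T' : measurableType d)
    (mu : {measure set T' -> \bar R}) (h f : T' -> \bar R) :
  measurable_fun setT h -> measurable_fun setT f -> (forall x, h x <= f x)%E ->
  (\int[mu]_x h x <= \int[mu]_x f x)%E.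
Proof.
move=> mh mf hf; rewrite integralE [leRHS]integralE leeB//.
- apply: ge0_le_integral => //; [exact: measurable_funepos|exact: measurable_funepos|].
  by move=> x _; apply: (@funepos_le _ _ setT) => //; rewrite inE.
- apply: ge0_le_integral => //; [exact: measurable_funeneg|exact: measurable_funeneg|].
  by move=> x _; apply: (@funeneg_le _ _ setT) => //; rewrite inE.
Qed.

Section Density.
Variables (n : nat) (Y : T -> n.-tuple R) (f : n.-tuple R -> R).
Hypothesis mY : measurable_fun setT Y.
Hypothesis fY : is_joint_density P Y f.

(** The law of [Y] is absolutely continuous and its Radon-Nikodym derivative agrees almost
    everywhere with [f]; both sides integrate [phi] against this law. *)
Lemma integral_density (phi : n.-tuple R -> R) :
  measurable_fun setT phi -> (forall x, 0 <= phi x) ->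
  (\int[lebesgue_tuple n]_x (phi x * f x)%:E = \int[P]_w (phi (Y w))%:E)%E.
Proof.
move=> mphi phi0; have [mf f0 fP] := fY.
pose Y' : {mfun T >-> n.-tuple R} :=
  HB.pack Y (isMeasurableFun.Build _ _ _ _ Y mY).
pose nu : probability (n.-tuple R) R := distribution P Y'.
have nuE A : measurable A -> nu A = (\int[lebesgue_tuple n]_(x in A) (f x)%:E)%E.
  exact: fP.
have mfE : measurable_fun setT (EFin \o f) by exact/measurable_EFinP.
have numu : nu `<< lebesgue_tuple n.
  apply/null_content_dominatesP => A mA A0; rewrite nuE//.
  by apply: null_set_integral => //; exact: measurable_funTS.
pose D := Radon_Nikodym_SigmaFinite.f nu (lebesgue_tuple n).
have Dint : (lebesgue_tuple n).-integrable setT D.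
  exact: Radon_Nikodym_SigmaFinite.f_integrable.
have Df : ae_eq (lebesgue_tuple n) setT D (EFin \o f).
  apply: integral_ae_eq => // A _ mA.
  exact: etrans (esym (Radon_Nikodym_SigmaFinite.f_integral numu mA)) (nuE _ mA).
have mphiE : measurable_fun setT (EFin \o phi) by exact/measurable_EFinP.
transitivity (\int[nu]_x (phi x)%:E)%E; last first.
  by have := @ge0_integral_pushforward _ _ _ _ R _ mY P setT (EFin \o phi)
    measurableT mphiE (fun x _ => phi0 x); rewrite preimage_setT.
have := @Radon_Nikodym_SigmaFinite.change_of_variables _ _ _ _ _ numu
  (EFin \o phi) setT (fun x => phi0 x) measurableT mphiE.
move=> <-; rewrite -/D.
apply: ge0_ae_eq_integral => //.
- by apply/measurable_EFinP; exact: measurable_funM.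
- by apply: emeasurable_funM; [exact/measurable_EFinP|exact: measurable_int Dint].
- by move=> x _; rewrite lee_fin mulr_ge0.
- by move=> x _; rewrite mule_ge0 ?lee_fin// Radon_Nikodym_SigmaFinite.f_ge0.
- by apply: filterS Df => x /= Dx xT; rewrite EFinM -Dx.
Qed.

End Density.

(** This is [1 + u <= expR u] at [u = - p - ln x], multiplied by [x]; at [x = 0] it reduces to
    [expR] being nonnegative. *)
Lemma gibbs_pointwise (x p : R) : 0 <= x ->
  - (expR (- p) + p * x) + x <= x * ln x.
Proof.
rewrite le_eqVlt => /predU1P[<-|x0].
  by rewrite !(mulr0, mul0r, addr0) oppr_le0 expR_ge0.
have := expR_ge1Dx (- p - ln x).
rewrite expRD [expR (- ln x)]expRN lnK ?posrE// => H.
have {}H : x * (1 - p - ln x) <= expR (- p).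
  rewrite -ler_pdivlMl// mulrC; apply: le_trans H.
  by rewrite addrA.
by lra.
Qed.

(* Gibbs' inequality against the density [expR (- c - psi)], whose mass is at
   most 1; it also rules out the value [+oo] that the integral of [f * ln f]
   would produce if its positive and negative parts were both infinite. *)
Lemma entropy_le n (Y : T -> n.-tuple R) (psi : n.-tuple R -> R) (c v : R) :
  measurable_fun setT Y -> has_joint_density P Y ->
  measurable_fun setT psi -> (forall x, 0 <= psi x) ->
  (\int[lebesgue_tuple n]_x (expR (- psi x))%:E <= (expR c)%:E)%E ->
  (\int[P]_w (psi (Y w))%:E <= v%:E)%E ->
  (entropy P Y <= (c + v)%:E)%E.
Proof.
move=> mY [f0 f0Y] mpsi psi0 gle vle.
rewrite /entropy; set f := joint_density P Y.
have fY : is_joint_density P Y f.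
  by rewrite /f /joint_density; apply: xgetPex; exists f0.
have [mf f_ge0 fP] := fY.
set mu := lebesgue_tuple n.
pose g x := expR (- (c + psi x)).
have mg : measurable_fun setT g.
  apply: measurableT_comp => //; apply: measurableT_comp => //.
  exact: measurable_funD.
have mpf : measurable_fun setT (fun x => psi x * f x) by exact: measurable_funM.
have intf : (\int[mu]_x (f x)%:E = 1)%E by rewrite -fP// preimage_setT probability_setT.
have intpf : (\int[mu]_x (psi x * f x)%:E <= v%:E)%E.
  by rewrite (integral_density mY fY mpsi psi0).
have intg : (\int[mu]_x (g x)%:E <= 1)%E.
  rewrite /g; under eq_integral do rewrite opprD expRD EFinM.
  rewrite ge0_integralZl_EFin ?expR_ge0//; last first.
    by apply/measurable_EFinP; apply: measurableT_comp => //; exact: measurableT_comp.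
  apply: (@le_trans _ _ ((expR (- c))%:E * (expR c)%:E)%E).
    by rewrite lee_wpmul2l// lee_fin expR_ge0.
  by rewrite -EFinM -expRD addNr expR0.
have If : mu.-integrable setT (EFin \o f).
  apply/integrableP; split; first exact/measurable_EFinP.
  by rewrite integral_fin_num_abs// intf.
have Ipf : mu.-integrable setT (EFin \o (fun x => psi x * f x)).
  apply/integrableP; split; first exact/measurable_EFinP.
  rewrite integral_fin_num_abs// ge0_fin_numE ?(le_lt_trans intpf) ?ltry//.
  by apply: integral_ge0 => x _; rewrite lee_fin mulr_ge0.
have Ig : mu.-integrable setT (EFin \o g).
  apply/integrableP; split; first exact/measurable_EFinP.
  rewrite integral_fin_num_abs// ge0_fin_numE ?(le_lt_trans intg) ?ltry//.
  by apply: integral_ge0 => x _; rewrite lee_fin expR_ge0.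
(* An integrable minorant of [f * ln f]: its integral is a lower bound even if [f * ln f] is not
   integrable. *)
pose h x := (((1 - c)%:E * (f x)%:E - (psi x * f x)%:E) - (g x)%:E)%E.
have Ih1 := integrableZl measurableT (1 - c) If.
have Ih2 := integrableB measurableT Ih1 Ipf.
have Ih : mu.-integrable setT h by exact: integrableB.
have inth : (\int[mu]_x h x = (1 - c)%:E - \int[mu]_x (psi x * f x)%:E
    - \int[mu]_x (g x)%:E)%E.
  rewrite /h integralB// integralB// integralZl//.
  by rewrite [X in (_ * X)%E]intf mule1.
have hle x : (h x <= (f x * ln (f x))%:E)%E.
  rewrite /h -EFinM -!EFinB lee_fin.
  apply: le_trans (gibbs_pointwise (c + psi x) (f_ge0 x)).
  by rewrite /g; lra.
rewrite leeNl.
apply: le_trans (le_integral_ge mu (measurable_int _ Ih) _ hle); last first.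
  apply/measurable_EFinP; apply: measurable_funM => //.
  exact: measurableT_comp (@measurable_ln R) mf.
have fin_pf := integrable_fin_num measurableT Ipf.
have fin_g := integrable_fin_num measurableT Ig.
rewrite inth -(fineK fin_pf) -(fineK fin_g) -!EFinB -EFinN lee_fin.
move: intpf intg; rewrite -{1}(fineK fin_pf) -{1}(fineK fin_g) !lee_fin.
by lra.
Qed.

(** Gibbs' inequality with the centred Gaussian density of precision matrix [Q]: [psi] is half the
    quadratic form and [c] the logarithm of the Gaussian integral. *)
Lemma entropy_le_posdef n (Y : T -> n.-tuple R) (Q : 'M[R]_n) (v : R) :
  measurable_fun setT Y -> has_joint_density P Y -> posdef Q ->
  (\int[P]_w (qform Q (row_of_tuple (Y w)))%:E <= v%:E)%E ->
  (entropy P Y <=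
   ((ln (2 * pi) *+ n - ln (\det Q)) / 2 + v / 2)%:E)%E.
Proof.
move=> mY dY pQ vle; have [d0 intQ] := integral_gauss pQ.
have Q0 x : 0 <= qform Q x.
  have [->|x0] := eqVneq x 0; first by rewrite /qform !mul0mx mxE.
  by case: pQ => _ /(_ _ x0)/ltW.
have mQ : measurable_fun setT (fun x : n.-tuple R => qform Q (row_of_tuple x) / 2).
  by apply: measurable_funM => //; exact: measurable_qform.
apply: (@entropy_le _ _ (fun x => qform Q (row_of_tuple x) / 2)) => //.
- by move=> x; rewrite divr_ge0.
- have pi2 : (0 : R) < 2 * pi by rewrite mulr_gt0// pi_gt0.
  under eq_integral do rewrite -mulNr.
  rewrite intQ lee_fin -lnXn// -ln_div ?posrE ?exprn_gt0//.
  set r := _ / \det Q; have r0 : 0 < r by rewrite divr_gt0// exprn_gt0.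
  rewrite -[leLHS]lnK ?posrE ?sqrtr_gt0// ler_expR.
  rewrite -[X in _ <= ln X / _](sqr_sqrtr (ltW r0)) lnXn ?sqrtr_gt0//.
  by rewrite -[X in X / _]mulr_natr mulfK.
- under eq_integral do rewrite EFinM.
  rewrite ge0_integralZr//.
  + by rewrite EFinM lee_wpmul2r// lee_fin.
  + apply/measurable_EFinP.
    exact: (measurableT_comp (measurable_qform Q) mY).
  + by move=> x _; rewrite lee_fin.
Qed.

End EntropyBound.

(** * Sums of roots of unity *)

Section RootsOfUnity.
Context {R : realType}.
Implicit Types (N : nat) (z : int).

Lemma cisD (a b : R) : cis (a + b) = cis a * cis b.
Proof.
apply/eqP; rewrite eq_complex /= cosD sinD; apply/andP; split; apply/eqP => //.
by rewrite addrC.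
Qed.

Definition angle N z : R := 2 * pi / N%:R * z%:~R.

Lemma angleD N z1 z2 : angle N (z1 + z2) = angle N z1 + angle N z2.
Proof. by rewrite /angle intrD mulrDr. Qed.

Lemma angleN N z : angle N (- z) = - angle N z.
Proof. by rewrite /angle intrN mulrN. Qed.

Lemma cis_angleX N z (j : nat) : cis (angle N (z * j%:Z)) = cis (angle N z) ^+ j.
Proof.
elim: j => [|j IH]; first by rewrite mulr0 expr0 /angle mulr0 /cis cos0 sin0.
by rewrite -addn1 PoszD mulrDr angleD cisD IH mulr1 exprD expr1.
Qed.

Lemma cis_angle_mulN N z : (0 < N)%N -> cis (angle N (N%:Z * z)) = 1.
Proof.
move=> N0; have N_neq0 : (N%:R : R) != 0 by rewrite pnatr_eq0 -lt0n.
have -> : angle N (N%:Z * z) = pi *+ 2 * z%:~R.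
  by rewrite /angle intrM -mulr_natl; field.
have cis2pi n : cis (pi *+ 2 * n%:R) = 1 :> R[i].
  rewrite mulr_natr -[X in cis X]add0r /cis.
  by rewrite (periodicn (@cosD2pi R)) (periodicn (@sinD2pi R)) cos0 sin0.
case: z => n; first exact: cis2pi.
have := cis2pi n.+1; rewrite NegzE intrN mulrN /cis cosN sinN => -[-> ->].
by rewrite oppr0.
Qed.

Lemma cis_angle_eq1 N z : (0 < N)%N ->
  (cis (angle N z) == 1) = (N%:Z %| z)%Z.
Proof.
move=> N0; rewrite {1}(divz_eq z N) angleD cisD [(z %/ N)%Z * N]mulrC.
rewrite cis_angle_mulN// mul1r.
have N_neq0 : (N%:R : R) != 0 by rewrite pnatr_eq0 -lt0n.
have NZ : (N%:Z != 0)%Z by rewrite eqz_nat -lt0n.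
rewrite dvdzE; apply/eqP/idP => [|/dvdz_mod0P]; last first.
  by rewrite /angle => ->; rewrite mulr0 /cis cos0 sin0.
have := modz_ge0 z NZ; have := ltz_pmod z (N0 : (0 < N%:Z)%R).
case E : (z %% N)%Z => [r|//] rN _ [c1 _].
apply/dvdz_mod0P; rewrite E; case: r => // r in E rN c1 *.
(* A nonzero remainder is impossible: half its angle, [x], lies strictly between 0 and [pi], so
   [sin x > 0], while [cos (x *+ 2) = 1] forces [sin x = 0]. *)
exfalso; pose x : R := pi / N%:R * r.+1%:R.
have xE : angle N r.+1 = x *+ 2 by rewrite /x -[LHS]/(2 * pi / N%:R * r.+1%:R); ring.
have : 0 < sin x.
  apply: sin_gt0_pi; rewrite !mulr_gt0 ?pi_gt0 ?invr_gt0 ?ltr0n//=.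
  by rewrite /x mulrAC ltr_pdivrMr ?ltr0n// ltr_pM2l ?pi_gt0// ltr_nat.
move: c1; rewrite xE cos_mulr2n cos2sin2 => c1 s0.
have := exprn_gt0 2 s0; lra.
Qed.

(** The offset [N * z0] contributes full turns only; what remains is a geometric sum over a root of
    unity, which vanishes unless the ratio is 1. *)
Lemma sum_cis_angle N z z0 : (0 < N)%N ->
  \sum_(j < N) cis (angle N (z * (N%:Z * z0 + j%:Z))) =
  if (N%:Z %| z)%Z then N%:R else 0.
Proof.
move=> N0.
have E (j : 'I_N) : cis (angle N (z * (N%:Z * z0 + j%:Z))) =
    cis (angle N z) ^+ j.
  rewrite mulrDr angleD cisD mulrCA cis_angle_mulN// mul1r.
  exact: cis_angleX.
under eq_bigr do rewrite E.
rewrite -cis_angle_eq1//; case: eqVneq => [->|z1].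
  by under eq_bigr do rewrite expr1n; rewrite sumr_const card_ord.
apply/eqP; rewrite -(inj_eq (mulfI (_ : cis (angle N z) - 1 != 0))) ?subr_eq0//.
by rewrite -subrX1 mulr0 subr_eq0 -cis_angleX mulrC cis_angle_mulN.
Qed.

End RootsOfUnity.

(** * Tails of absolutely convergent sums *)

Section RealSum.
Context {R : realType} (I : choiceType).

Lemma esum_seqID (g : I -> R) (s : seq I) : uniq s -> (forall i, 0 <= g i) ->
  (\esum_(i in [set: I]) (g i)%:E =
   (\sum_(i <- s) g i)%:E + \esum_(i in ~` [set` s]) (g i)%:E)%E.
Proof.
move=> us g0; rewrite (esumID [set` s])//; last by move=> i _; rewrite lee_fin.
rewrite !setTI esum_fset//; last by move=> i _; rewrite lee_fin.
by rewrite -fsbig_seq ?sumEFin.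
Qed.

(** As [real_sum] is a difference of extended sums, [f] is split into its positive and negative
    parts. Outside [s] their sums are finite and together at most that of [g], which is the right
    side. *)
Lemma real_sum_tail (f g : I -> R) (s : seq I) : uniq s ->
  (forall i, `|f i| <= g i) -> (\esum_(i in [set: I]) (g i)%:E < +oo)%E ->
  `|\sum_(i <- s) f i - real_sum f| <=
  fine (\esum_(i in [set: I]) (g i)%:E) - \sum_(i <- s) g i.
Proof.
move=> us fg goo.
have g0 i : 0 <= g i by apply: le_trans (fg i).
pose p i := Num.max (f i) 0; pose q i := Num.max (- f i) 0.
have p0 i : 0 <= p i by rewrite le_max lexx orbT.
have q0 i : 0 <= q i by rewrite le_max lexx orbT.
have pq i : f i = p i - q i.
  by rewrite /p /q; case: (leP (f i) 0); case: (leP (- f i) 0); lra.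
have pqg i : p i + q i <= g i.
  have := fg i; rewrite /p /q ler_norml => /andP[].
  by have := g0 i; case: (leP (f i) 0); case: (leP (- f i) 0); lra.
set A := ~` [set` s].
have fin_le (h : I -> R) : (forall i, 0 <= h i) -> (forall i, h i <= g i) ->
    (\esum_(i in A) (h i)%:E)%E \is a fin_num.
  move=> h0 hg; rewrite ge0_fin_numE; last by apply: esum_ge0 => i _; rewrite lee_fin.
  apply: le_lt_trans goo; rewrite (esum_seqID us g0).
  apply: (@le_trans _ _ (\esum_(i in A) (g i)%:E)%E).
    by apply: le_esum => i _; rewrite lee_fin.
  by rewrite leeDr// lee_fin sumr_ge0.
have [[rp rpE] [rq rqE] [rg rgE]] : [/\ exists r, (\esum_(i in A) (p i)%:E)%E = r%:E,
    exists r, (\esum_(i in A) (q i)%:E)%E = r%:E &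
    exists r, (\esum_(i in A) (g i)%:E)%E = r%:E].
  by split; eexists; rewrite -[LHS]fineK//; apply: fin_le => // i; have := pqg i;
    have := p0 i; have := q0 i; lra.
have real_sumE : real_sum f = \sum_(i <- s) f i + (rp - rq).
  rewrite /real_sum.
  have -> : (esum setT (EFin \o f)^\+)%E = (\esum_(i in setT) (p i)%:E)%E.
    by apply: eq_esum => i _; rewrite funeposE /= EFin_max.
  have -> : (esum setT (EFin \o f)^\-)%E = (\esum_(i in setT) (q i)%:E)%E.
    by apply: eq_esum => i _; rewrite funenegE /= EFin_max.
  rewrite (esum_seqID us p0) (esum_seqID us q0) rpE rqE /=.
  by rewrite (eq_bigr _ (fun i _ => pq i)) sumrB; ring.
rewrite real_sumE (esum_seqID us g0) rgE /=.
have : rp + rq <= rg.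
  rewrite -lee_fin EFinD -rpE -rqE -rgE -esumD; [|by move=> *; rewrite lee_fin..].
  by apply: le_esum => i _; rewrite -EFinD lee_fin.
have : 0 <= rp by rewrite -lee_fin -rpE esum_ge0// => i _; rewrite lee_fin.
have : 0 <= rq by rewrite -lee_fin -rqE esum_ge0// => i _; rewrite lee_fin.
by rewrite ler_norml => *; apply/andP; split; lra.
Qed.

End RealSum.

(** * Second moments of linear combinations of the field *)

Section SecondMoments.
Context {R : realType} {disp : measure_display} {T : measurableType disp}.
Variables (P : probability T R) (J : zmodType) (X : J -> {RV P >-> R}).
Variable K : J -> R.
Hypothesis X_cov : forall i j, 'E_P[(X i : T -> R) \* X j]%E = (K (i - j))%:E.

(** A finite value in [X_cov] forces integrability: the integral would be infinite if the positive
    or the negative part had infinite mass. *)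
Lemma integrable_cov i j : P.-integrable setT (fun w => (X i w * X j w)%:E).
Proof.
have mX : measurable_fun setT (fun w => X i w * X j w) by exact: measurable_funM.
apply/integrableP; split; first exact/measurable_EFinP.
rewrite integral_fin_num_abs//.
by have := X_cov i j; rewrite unlock /= => ->.
Qed.

Lemma integral_sqr_lincomb (I : finType) (p : I -> J) (a : I -> R) :
  (\int[P]_w ((\sum_k a k * X (p k) w) ^+ 2)%:E =
   (\sum_k \sum_l a k * a l * K (p k - p l))%:E)%E.
Proof.
have E w : (((\sum_k a k * X (p k) w) ^+ 2)%:E =
    \sum_k \sum_l (a k * a l)%:E * (X (p k) w * X (p l) w)%:E)%E.
  rewrite expr2 mulr_suml -sumEFin; apply: eq_bigr => k _.
  rewrite mulr_sumr -sumEFin; apply: eq_bigr => l _.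
  by rewrite -EFinM; congr EFin; ring.
under eq_integral do rewrite E.
have intX k l : P.-integrable setT
    (fun w => ((a k * a l)%:E * (X (p k) w * X (p l) w)%:E)%E).
  by apply: integrableZl => //; exact: integrable_cov.
rewrite integral_sum//; last by move=> k; exact: integrable_sum.
rewrite -sumEFin; apply: eq_bigr => k _.
rewrite integral_sum// -sumEFin; apply: eq_bigr => l _.
rewrite integralZl//; last exact: integrable_cov.
by have := X_cov (p k) (p l); rewrite unlock /= EFinM => ->.
Qed.

Lemma cov_psd (I : finType) (p : I -> J) (a : I -> R) :
  0 <= \sum_k \sum_l a k * a l * K (p k - p l).
Proof.
rewrite -lee_fin -integral_sqr_lincomb integral_ge0// => w _.
by rewrite lee_fin sqr_ge0.
Qed.

End SecondMoments.

(** * Tiling of the lattice and the Hartley transform on a tile *)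

Section Tiles.
Context {R : realType}.
Variables (d N : nat).
Hypothesis N_gt0 : (0 < N)%N.
Implicit Types (i k l m t : 'rV[int]_d) (r : {ffun 'I_d -> 'I_N}).

(** Division by a positive [N] rounds down for negative coordinates too, so all tiles are translates
    of one cube. *)
Definition tile_of i : 'rV[int]_d := \row_c (i 0%R c %/ N)%Z.

Definition tile_site t r : 'rV[int]_d := \row_c (N%:Z * t 0 c + (r c)%:Z).

Definition idot k i : int := \sum_c k 0 c * i 0 c.

Lemma idotBr k i j : idot k (i - j) = idot k i - idot k j.
Proof. by rewrite /idot -sumrB; apply: eq_bigr => c _; rewrite !mxE mulrBr. Qed.

Lemma idotBl k l i : idot (k - l) i = idot k i - idot l i.
Proof. by rewrite /idot -sumrB; apply: eq_bigr => c _; rewrite !mxE mulrBl. Qed.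

Lemma idotDl k l i : idot (k + l) i = idot k i + idot l i.
Proof. by rewrite /idot -big_split; apply: eq_bigr => c _; rewrite !mxE mulrDl. Qed.

Lemma tile_of_site t r : tile_of (tile_site t r) = t.
Proof.
apply/rowP => c; rewrite !mxE mulrC divzMDl ?eqz_nat -?lt0n//.
by rewrite divz_small ?addr0//= ltz_nat ltn_ord.
Qed.

Lemma tile_site_inj t : injective (tile_site t).
Proof.
move=> r r' /rowP rr'; apply/ffunP => c; apply/val_inj.
by have := rr' c; rewrite !mxE => /addrI[].
Qed.

Lemma tile_site_surj i : exists r, i = tile_site (tile_of i) r.
Proof.
have NZ : (N%:Z != 0)%Z by rewrite eqz_nat -lt0n.
have lt_mod c : (absz (i 0%R c %% N)%Z < N)%N.
  by rewrite -ltz_nat gez0_abs ?modz_ge0// ltz_pmod.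
exists [ffun c => Ordinal (lt_mod c)]; apply/rowP => c.
by rewrite !mxE ffunE /= gez0_abs ?modz_ge0// mulrC -divz_eq.
Qed.

Lemma sum_cis_tile m t :
  \sum_r cis (angle N (idot m (tile_site t r))) =
  (if [forall c, (N%:Z %| m 0%R c)%Z] then (N ^ d)%:R else 0) :> R[i].
Proof.
have E r : cis (angle N (idot m (tile_site t r))) =
    \prod_c cis (angle N (m 0 c * (N%:Z * t 0 c + (r c)%:Z))) :> R[i].
  rewrite /idot; elim/big_rec2: _ => [|c y z _ <-].
    by rewrite /angle mulr0 /cis cos0 sin0.
  by rewrite !mxE angleD cisD.
under eq_bigr do rewrite E.
rewrite -(bigA_distr_bigA (fun c (j : 'I_N) =>
  cis (angle N (m 0 c * (N%:Z * t 0 c + j%:Z))))).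
under eq_bigr do rewrite sum_cis_angle//.
case: ifPn => [/forallP Nm|/forallPn[c Nmc]].
  by under eq_bigr do rewrite Nm; rewrite prodr_const card_ord natrX.
by rewrite (bigD1 c)//= (negbTE Nmc) mul0r.
Qed.

Lemma sum_cos_sin_tile m t :
  \sum_r cos (angle N (idot m (tile_site t r))) =
    (if [forall c, (N%:Z %| m 0%R c)%Z] then (N ^ d)%:R else 0) :> R /\
  \sum_r sin (angle N (idot m (tile_site t r))) = 0 :> R.
Proof.
have C (F : {ffun 'I_d -> 'I_N} -> R) : (\sum_r cis (F r)) =
    Complex (\sum_r cos (F r)) (\sum_r sin (F r)).
  by elim/big_rec3: _ => // r x y z _ ->.
have := sum_cis_tile m t; rewrite C; case: ifP => _.
  by rewrite -(rmorph_nat (real_complex R)) => -[].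
by case.
Qed.

(** Hartley's kernel, a real substitute for the complex exponential. *)
Definition cas (x : R) := cos x + sin x.

(** Shifting [i] or [k] by a multiple of [N] changes nothing, so the points of a tile serve both as
    its sites and as its frequencies. *)
Definition hartley i k : R :=
  (Num.sqrt (N ^ d)%:R)^-1 * cas (angle N (idot k i)).

(** By [cas a * cas b = cos (a - b) + sin (a + b)]: the sines sum to 0, and so do the cosines unless
    [N] divides every coordinate of [k - l], which inside one tile means [k = l]. *)
Lemma hartley_orthonormal k l t : tile_of k = t -> tile_of l = t ->
  \sum_r hartley (tile_site t r) k * hartley (tile_site t r) l = (k == l)%:R.
Proof.
move=> kt lt_.
have Nd0 : (N ^ d)%:R != 0 :> R by rewrite pnatr_eq0 -lt0n expn_gt0 N_gt0.
have E r : hartley (tile_site t r) k * hartley (tile_site t r) l =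
    (N ^ d)%:R^-1 * (cos (angle N (idot (k - l) (tile_site t r))) +
                     sin (angle N (idot (k + l) (tile_site t r)))).
  rewrite /hartley mulrACA -invfM -expr2 sqr_sqrtr//; congr (_ * _).
  by rewrite idotBl idotDl angleD angleN angleD cosB sinD /cas; ring.
under eq_bigr do rewrite E.
rewrite -mulr_sumr big_split /=.
rewrite (sum_cos_sin_tile (k - l) t).1 (sum_cos_sin_tile (k + l) t).2 addr0.
have -> : [forall c, (N%:Z %| (k - l)%R 0%R c)%Z] = (k == l).
  apply/forallP/eqP => [Nkl|-> c]; last by rewrite subrr mxE dvdz0.
  have [r kr] := tile_site_surj k; have [r' lr'] := tile_site_surj l.
  rewrite kr lr' kt lt_; congr (tile_site _ _); apply/ffunP => c; apply/val_inj.
  have := Nkl c; rewrite kr lr' kt lt_ !mxE opprD addrACA subrr add0r.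
  rewrite -eqz_mod_dvd => /eqP.
  by rewrite !modz_small ?ltz_nat ?ltn_ord//= => -[].
by case: eqVneq => _; rewrite ?mulr0// mulVf.
Qed.

End Tiles.

(** * Energy of a frequency in a tile, bounded by Fejer means *)

Section TileEnergy.
Context {R : realType}.
Variables (d N : nat) (K : 'rV[int]_d -> R).
Hypothesis N_gt0 : (0 < N)%N.
Hypothesis K_l1 : summable [set: 'rV[int]_d] (EFin \o K).
Hypothesis K_psd : forall (I : finType) (p : I -> 'rV[int]_d) (a : I -> R),
  0 <= \sum_k \sum_l a k * a l * K (p k - p l).
Implicit Types (i k l m t : 'rV[int]_d) (r : {ffun 'I_d -> 'I_N}).
Local Notation site := (@tile_site d N).

Definition l1norm : R := fine (\esum_(j in [set: 'rV[int]_d]) `|K j|%:E)%E.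

Lemma l1normE : (\esum_(j in [set: 'rV[int]_d]) `|K j|%:E)%E = l1norm%:E.
Proof. by rewrite /l1norm fineK//; move: K_l1; rewrite summableE. Qed.

Lemma sum_seq_le_l1norm (s : seq 'rV[int]_d) : uniq s ->
  \sum_(j <- s) `|K j| <= l1norm.
Proof.
move=> us; rewrite -lee_fin -l1normE (esum_seqID us)// leeDl// esum_ge0//.
Qed.

Lemma norm_K_le j : `|K j| <= l1norm.
Proof. by have := @sum_seq_le_l1norm [:: j] isT; rewrite big_seq1. Qed.

Lemma l1norm_approx (e : R) : 0 < e ->
  exists2 B : seq 'rV[int]_d, uniq B & l1norm - \sum_(j <- B) `|K j| <= e.
Proof.
move=> e0.
have : ((l1norm - e)%:E < \esum_(j in [set: 'rV[int]_d]) `|K j|%:E)%E.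
  by rewrite l1normE lte_fin; lra.
rewrite /esum => /ereal_sup_gt[_ [A [finA _] <-]].
rewrite fsbig_finite//= sumEFin lte_fin => H.
by exists (fset_set A); [exact: fset_uniq|lra].
Qed.

(** When [K] is the covariance, this is the second moment of the Hartley coefficient of the field at
    frequency [k] in the tile [t]. *)
Definition tile_energy t k : R := \sum_r \sum_r'
  hartley N (site t r) k * hartley N (site t r') k *
  K (site t r - site t r').

(** The part of the cosine series of the structure function at [2 * pi * k / N] whose lags lead from
    the site of [r'] to sites of the tile. Averaging over [r'] gives a Fejer mean. *)
Definition fejer_row t k r' : R := \sum_r
  cos (angle N (idot k (site t r - site t r'))) *
  K (site t r - site t r').

(* [cas a * cas b + (cos a - sin a) * (cos b - sin b) = 2 * cos (a - b)]. *)
Lemma tile_energy_le t k :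
  tile_energy t k <= 2 / (N ^ d)%:R * \sum_r' fejer_row t k r'.
Proof.
have Nd0 : 0 < (N ^ d)%:R :> R by rewrite ltr0n expn_gt0 N_gt0.
pose u r := angle N (idot k (site t r)) : R.
have := K_psd (site t) (fun r => cos (u r) - sin (u r)).
set S' := (X in 0 <= X) => S'0.
suff : 2 / (N ^ d)%:R * \sum_r' fejer_row t k r' =
    tile_energy t k + (N ^ d)%:R^-1 * S'.
  by move=> ->; rewrite lerDl mulr_ge0// invr_ge0 ltW.
rewrite /fejer_row exchange_big /S' /tile_energy !mulr_sumr -big_split/=.
apply: eq_bigr => r _; rewrite !mulr_sumr -big_split/=; apply: eq_bigr => r' _.
rewrite /hartley [X in _ = X * _ + _]mulrACA -invfM -expr2 sqr_sqrtr ?ltW//.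
by rewrite idotBr angleD angleN cosB /cas -/(u r) -/(u r'); ring.
Qed.

Let diffs t r' := [seq site t r - site t r' | r : {ffun 'I_d -> 'I_N}].

Let uniq_diffs t r' : uniq (diffs t r').
Proof.
rewrite map_inj_uniq ?enum_uniq// => r1 r2 /addIr.
exact: tile_site_inj.
Qed.

Let fejer_rowE t k r' : fejer_row t k r' =
  \sum_(j <- diffs t r') cos (angle N (idot k j)) * K j.
Proof. by rewrite big_map big_enum. Qed.

Lemma fejer_row_le t k r' : fejer_row t k r' <= l1norm.
Proof.
apply: le_trans (sum_seq_le_l1norm (uniq_diffs t r')); rewrite fejer_rowE.
apply: ler_sum => j _; apply: le_trans (ler_norm _) _; rewrite normrM.
by rewrite ler_piMl// cos_max.
Qed.

Definition deep b r := [forall c, (b <= r c)%N && (r c + b < N)%N].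

(** The full cosine series has sum 0, so the row is minus the part of the series that it misses. The
    lags available at a deep site include all of [B], hence that part has absolute sum at most
    [e]. *)
Lemma fejer_row_deep t k r' (b : nat) (B : seq 'rV[int]_d) (e : R) :
  real_sum (fun j => cos (angle N (idot k j)) * K j) = 0 ->
  uniq B -> (forall j c, j \in B -> (`|j 0%R c| <= b)%N) ->
  l1norm - \sum_(j <- B) `|K j| <= e -> deep b r' ->
  fejer_row t k r' <= e.
Proof.
move=> S0 uB Bb Be /forallP dr.
have sB : {subset B <= diffs t r'}.
  move=> j jB.
  have ltN c : (absz ((r' c)%:Z + j 0 c)%R < N)%N.
    have := Bb _ c jB; have /andP[] := dr c; lia.
  apply/mapP; exists [ffun c => Ordinal (ltN c)]; first by rewrite mem_enum.
  apply/rowP => c; rewrite !mxE ffunE /= gez0_abs; first by ring.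
  have rc : (`|j 0%R c| <= r' c)%N.
    by apply: leq_trans (Bb _ c jB) _; have /andP[] := dr c.
  move: rc; rewrite -lez_nat abszE ler_norml => /andP[].
  by rewrite -subr_ge0 opprK addrC.
apply: le_trans Be; apply: le_trans (ler_norm _) _.
have := @real_sum_tail _ _ (fun j => cos (angle N (idot k j)) * K j)
  (fun j => `|K j|) _ (uniq_diffs t r').
rewrite S0 subr0 -fejer_rowE => /(_ _ _)/le_trans; apply.
- by move=> j; rewrite normrM ler_piMl// cos_max.
- by rewrite l1normE ltry.
rewrite lerD2l lerN2 -/l1norm [leRHS](bigID (mem B))/= -[leLHS]addr0.
rewrite lerD ?sumr_ge0// -[leRHS]big_filter.
rewrite (perm_big [seq j <- diffs t r' | j \in B])//.
apply: uniq_perm => //; first exact: seq.filter_uniq.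
by move=> j; rewrite seq.mem_filter /=; case: (boolP (j \in B)) => // /sB ->.
Qed.

Lemma card_ffun_at (c : 'I_d) (A : pred 'I_N) :
  (#|[pred r : {ffun 'I_d -> 'I_N} | A (r c)]| * N = #|A| * N ^ d)%N.
Proof.
rewrite -sum1_card -[#|A|]sum1_card big_mkcond [in RHS]big_mkcond /=.
have -> : (\sum_(r : {ffun 'I_d -> 'I_N}) (if A (r c) then 1 else 0) =
   \sum_(r : {ffun 'I_d -> 'I_N})
     \prod_c' (if c' == c then (if A (r c') then 1 else 0) else 1))%N.
  apply: eq_bigr => r _; rewrite (bigD1 c)//= eqxx big1 ?muln1// => c' c'c.
  by rewrite (negbTE c'c).
rewrite -(bigA_distr_bigA (fun c' (j : 'I_N) =>
   if c' == c then (if A j then 1 else 0) else 1)%N).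
rewrite (bigD1 c)//= eqxx -mulnA; congr (_ * _)%N.
under eq_bigr => c' c'c do rewrite (negbTE c'c) sum1_card card_ord.
rewrite prod_nat_const mulnC -expnS; congr expn.
have := cardC1 c; rewrite card_ord => ->.
by rewrite prednK// (leq_ltn_trans _ (ltn_ord c)).
Qed.

(** Union bound over the [d] coordinates: each has at most [2 * b] values too close to an end. *)
Lemma card_not_deep b :
  (#|[pred r : {ffun 'I_d -> 'I_N} | ~~ deep b r]| * N <= 2 * b * d * N ^ d)%N.
Proof.
pose A : pred 'I_N := fun j => ~~ ((b <= j)%N && (j + b < N)%N).
have cardA : (#|A| <= 2 * b)%N.
  rewrite cardE -(size_map val) -[(2 * b)%N](_ : size (iota 0 b ++ iota (N - b) b) = _).
    apply: uniq_leq_size; first by rewrite map_inj_uniq ?enum_uniq//; exact: val_inj.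
    move=> _ /mapP[j + ->]; rewrite mem_enum mem_cat !mem_iota => jA.
    by have := ltn_ord j; move: jA; rewrite /in_mem/= /A; lia.
  by rewrite size_cat !size_iota; lia.
apply: (@leq_trans ((\sum_(c < d) #|[pred r : {ffun 'I_d -> 'I_N} | A (r c)]|) * N)).
  rewrite leq_mul2r; apply/orP; right.
  under eq_bigr do rewrite -sum1_card big_mkcond/=.
  rewrite -sum1_card big_mkcond/= exchange_big/=; apply: leq_sum => r _.
  case: ifPn => // /forallPn[c rc]; rewrite (bigD1 c)//=.
  by rewrite inE /A rc.
rewrite big_distrl /=; under eq_bigr do rewrite card_ffun_at.
rewrite -big_distrl/= leq_mul2r; apply/orP; right.
by rewrite sum_nat_const card_ord mulnC leq_mul.
Qed.

Lemma tile_energy_le_l1norm t k : tile_energy t k <= 2 * l1norm.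
Proof.
have Nd0 : 0 < (N ^ d)%:R :> R by rewrite ltr0n expn_gt0 N_gt0.
apply: le_trans (tile_energy_le t k) _.
rewrite -mulrA ler_pM2l// ler_pdivrMl//.
apply: (@le_trans _ _ (\sum_(r : {ffun 'I_d -> 'I_N}) l1norm)).
  by apply: ler_sum => r _; exact: fejer_row_le.
by rewrite sumr_const card_ffun !card_ord -[leLHS]mulr_natl.
Qed.

(** Deep rows are at most [e] each. The others are at most [l1norm K] but form a proportion at most
    [2 * b * d / N], so by the condition on [N] they add at most another [e] to the average, which
    [tile_energy_le] then doubles. *)
Lemma tile_energy_low t k (b : nat) (B : seq 'rV[int]_d) (e : R) :
  real_sum (fun j => cos (angle N (idot k j)) * K j) = 0 ->
  uniq B -> (forall j c, j \in B -> (`|j 0%R c| <= b)%N) ->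
  l1norm - \sum_(j <- B) `|K j| <= e -> 0 <= e ->
  (2 * b * d)%:R * l1norm <= e * N%:R ->
  tile_energy t k <= 4 * e.
Proof.
move=> S0 uB Bb Be e0 Ne.
have Nd0 : 0 < (N ^ d)%:R :> R by rewrite ltr0n expn_gt0 N_gt0.
have N0 : 0 < N%:R :> R by rewrite ltr0n.
have n0 : 0 <= l1norm by apply: le_trans (norm_K_le 0).
apply: le_trans (tile_energy_le t k) _.
suff : \sum_r' fejer_row t k r' <= 2 * e * (N ^ d)%:R.
  by move=> ?; rewrite [leLHS]mulrAC ler_pdivrMr//; lra.
rewrite (bigID (deep b))/=.
have H1 : \sum_(r | deep b r) fejer_row t k r <= e * (N ^ d)%:R.
  apply: (@le_trans _ _ (\sum_(r | deep b r) e)).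
    by apply: ler_sum => r; exact: fejer_row_deep Be.
  rewrite sumr_const -[leLHS]mulr_natr ler_wpM2l// ler_nat.
  by apply: leq_trans (max_card _) _; rewrite card_ffun !card_ord.
have H2 : \sum_(r | ~~ deep b r) fejer_row t k r <= e * (N ^ d)%:R.
  apply: (@le_trans _ _ (\sum_(r | ~~ deep b r) l1norm)).
    by apply: ler_sum => r _; exact: fejer_row_le.
  rewrite sumr_const -[leLHS]mulr_natl -(ler_pM2r N0) mulrAC -natrM.
  apply: (@le_trans _ _ ((2 * b * d * N ^ d)%:R * l1norm)).
    by rewrite ler_wpM2r// ler_nat card_not_deep.
  rewrite natrM mulrAC [leRHS]mulrAC ler_wpM2r// ltW//.
by lra.
Qed.

End TileEnergy.

(** * The orthogonal transform on a finite set of sites *)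

Section TileTransform.
Context {R : realType}.
Variables (d N : nat).
Hypothesis N_gt0 : (0 < N)%N.
Variable F : {fset 'rV[int]_d}.
Implicit Types (i j k l t : 'rV[int]_d).
Local Notation site := (@tile_site d N).

Definition full_tile t := [forall r, site t r \in F].

Lemma sum_full_tile (V : nmodType) t (g : 'rV[int]_d -> V) : full_tile t ->
  \sum_(i <- F | tile_of N i == t) g i = \sum_r g (site t r).
Proof.
move=> /forallP Ft.
rewrite -big_filter (perm_big [seq site t r | r : {ffun 'I_d -> 'I_N}]).
  by rewrite big_map big_enum.
apply: uniq_perm; first exact/seq.filter_uniq/fset_uniq.
  by rewrite map_inj_uniq ?enum_uniq//; exact: tile_site_inj.
move=> i; rewrite seq.mem_filter; apply/andP/mapP => [[/eqP it iF]|[r _ ->]].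
  have [r ir] := tile_site_surj N_gt0 i.
  by exists r; [rewrite mem_enum|rewrite -it].
by rewrite tile_of_site// eqxx Ft.
Qed.

(* The Hartley transform on the full tiles, the identity on the other sites:
   column [k] is supported in the tile of [k] and [k] itself is the frequency. *)
Definition tile_coef i k : R :=
  if full_tile (tile_of N k) then
    if tile_of N i == tile_of N k then hartley N i k else 0
  else (i == k)%:R.

(** Columns from different tiles have disjoint supports; within a full tile they are Hartley
    vectors, and elsewhere unit vectors. *)
Lemma tile_coef_orthonormal k l : k \in F -> l \in F ->
  \sum_(i <- F) tile_coef i k * tile_coef i l = (k == l)%:R.
Proof.
move=> kF lF; rewrite /tile_coef.
case: (boolP (full_tile (tile_of N k))) => Fk; last first.
  rewrite (big_fsetD1 k)//= big1_seq ?addr0; last first.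
    by move=> i /andP[_]; rewrite !inE => /andP[/negbTE -> _]; rewrite mul0r.
  rewrite eqxx mul1r; case: ifP => // Fl.
  case: eqVneq => [kl|_]; first by rewrite kl Fl in Fk.
  by rewrite (_ : (k == l) = false)//; apply/eqP => kl; rewrite kl Fl in Fk.
case: (eqVneq (tile_of N l) (tile_of N k)) => [lk|lk].
  rewrite -(hartley_orthonormal N_gt0 erefl lk) lk Fk.
  rewrite -(sum_full_tile (fun i => hartley N i k * hartley N i l))//.
  rewrite [RHS]big_mkcond/=; apply: eq_bigr => i _.
  by case: eqP => _; rewrite ?mul0r.
have -> : (k == l) = false by apply/eqP => kl; rewrite kl eqxx in lk.
rewrite big1// => i _; case: eqP => [ik|_]; last by rewrite mul0r.
case: ifP => _; first by rewrite ik eq_sym (negbTE lk) mulr0.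
have [il|_] := eqVneq i l; last by rewrite mulr0.
by rewrite -il ik eqxx in lk.
Qed.

Lemma tile_coef_energy (K : 'rV[int]_d -> R) k : k \in F ->
  \sum_(i <- F) \sum_(j <- F) tile_coef i k * tile_coef j k * K (i - j) =
  if full_tile (tile_of N k) then tile_energy N K (tile_of N k) k else K 0.
Proof.
move=> kF; rewrite /tile_coef; case: ifP => Fk.
  rewrite /tile_energy -(sum_full_tile (fun i => \sum_r' hartley N i k *
    hartley N (site (tile_of N k) r') k * K (i - site (tile_of N k) r')))//.
  rewrite [RHS]big_mkcond/=; apply: eq_bigr => i _; case: eqP => _.
    rewrite -(sum_full_tile (fun j => hartley N i k * hartley N j k * K (i - j)))//.
    rewrite [RHS]big_mkcond/=; apply: eq_bigr => j _.
    by case: eqP => _; rewrite ?mulr0 ?mul0r.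
  by rewrite big1// => j _; rewrite !mul0r.
rewrite (big_fsetD1 k)//= [X in _ + X]big1_seq ?addr0; last first.
  move=> i /andP[_]; rewrite !inE => /andP[/negbTE -> _].
  by rewrite big1// => j _; rewrite !mul0r.
rewrite (big_fsetD1 k)//= big1_seq ?addr0; last first.
  by move=> i /andP[_]; rewrite !inE => /andP[/negbTE -> _]; rewrite mulr0 mul0r.
by rewrite eqxx !mul1r subrr.
Qed.

End TileTransform.

(** [v *m W] takes the coordinates of [v] in the orthonormal columns of [U] and scales the one of
    index [k] by [s k]. The Gram matrix is to be the precision matrix of the comparison Gaussian. *)
Lemma gram_scaled_orthogonal (R : realType) n (U : 'M[R]_n) (s : 'I_n -> R) :
  U^T *m U = 1%:M -> (forall k, 0 < s k) ->
  let W := U *m diag_mx (\row_k s k) in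
  [/\ posdef (W *m W^T), \det (W *m W^T) = \prod_k s k ^+ 2 &
      forall v, qform (W *m W^T) v = \sum_k (s k * (v *m U) 0 k) ^+ 2].
Proof.
move=> UU s0 W.
have qE v : qform (W *m W^T) v = \sum_k (s k * (v *m U) 0 k) ^+ 2.
  rewrite /qform mulmxA -mulmxA -trmx_mul mxE; apply: eq_bigr => k _.
  by rewrite [_^T _ _]mxE mulmxA mul_mx_diag !mxE; ring.
have UU' : U *m U^T = 1%:M by exact: mulmx1C.
split=> //; last first.
  rewrite det_mulmx det_tr -expr2 det_mulmx exprMn det_diag.
  have -> : \det U ^+ 2 = 1 by rewrite expr2 -{1}det_tr -det_mulmx UU det1.
  by rewrite mul1r prodrXl; congr (_ ^+ 2); apply: eq_bigr => k _; rewrite mxE.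
split; first by rewrite trmx_mul trmxK.
move=> v v0; rewrite qE lt_neqAle sumr_ge0 ?andbT => [|k _]; last exact: sqr_ge0.
rewrite eq_sym psumr_eq0 => [|k _]; last exact: sqr_ge0.
apply: contra v0 => /allP vU0.
have : v *m U = 0.
  apply/rowP => k; rewrite [RHS]mxE; apply/eqP.
  have /= := vU0 k (mem_index_enum _).
  by rewrite sqrf_eq0 mulf_eq0 gt_eqF// s0.
by move=> /(congr1 (mulmx^~ U^T)); rewrite -mulmxA UU' mulmx1 mul0mx => ->.
Qed.

Lemma ln_prod (R : realType) (I : Type) (r : seq I) (f : I -> R) :
  (forall i, 0 < f i) -> ln (\prod_(i <- r) f i) = \sum_(i <- r) ln (f i).
Proof.
move=> f0; elim: r => [|i r IH]; first by rewrite !big_nil ln1.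
by rewrite !big_cons lnM ?posrE ?prodr_gt0// IH.
Qed.

(** * Entropy of the field after transforming and rescaling *)

Section FieldEntropy.
Context {R : realType} {disp : measure_display} {T : measurableType disp}.
Variables (P : probability T R) (d : nat).
Variables (X : 'rV[int]_d -> {RV P >-> R}) (K : 'rV[int]_d -> R).
Hypothesis X_cov : forall i j, 'E_P[(X i : T -> R) \* X j]%E = (K (i - j))%:E.
Variable N : nat.
Hypothesis N_gt0 : (0 < N)%N.
Variable F : {fset 'rV[int]_d}.
Hypothesis F_density : has_joint_density P (field_restr X F).

(** Each term of the sum bounded by [v] is the second moment of a transformed and rescaled
    coordinate, so [v] bounds the expected quadratic form; the product of the [s k ^+ 2] is its
    determinant. *)
Lemma entropy_field_le (s : 'rV[int]_d -> R) (v : R) :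
  (forall k, 0 < s k) ->
  \sum_(k <- F) s k ^+ 2 * (if full_tile N F (tile_of N k) then
    tile_energy N K (tile_of N k) k else K 0) <= v ->
  (entropy P (field_restr X F) <=
   ((ln (2 * pi) *+ size F - \sum_(k <- F) ln (s k ^+ 2)) / 2 + v / 2)%:E)%E.
Proof.
move=> s0 sv.
pose p (i : 'I_(size F)) := tnth (in_tuple F) i.
have pF i : p i \in F by exact: mem_tnth.
have p_inj : injective p by apply/tuple_uniqP; exact: fset_uniq.
have sumF (g : 'rV[int]_d -> R) : \sum_(i <- F) g i = \sum_i g (p i).
  by rewrite big_tnth.
pose U : 'M[R]_(size F) := \matrix_(i, k) tile_coef N F (p i) (p k).
have UU : U^T *m U = 1%:M.
  apply/matrixP => k l; rewrite !mxE -(inj_eq p_inj).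
  rewrite -(@tile_coef_orthonormal R _ _ N_gt0 F _ _ (pF k) (pF l)) sumF.
  by apply: eq_bigr => i _; rewrite !mxE.
have [pdQ detQ qfQ] := gram_scaled_orthogonal UU (fun k => s0 (p k)).
set Q := _ *m _^T in pdQ detQ qfQ.
have mY : measurable_fun setT (field_restr X F).
  apply/measurable_fun_tnthP => i.
  rewrite (_ : _ \o _ = X (p i))//.
  by apply/funext => w /=; rewrite tnth_map.
have -> : \sum_(k <- F) ln (s k ^+ 2) = ln (\det Q).
  by rewrite detQ ln_prod => [|k]; [rewrite sumF|rewrite exprn_gt0].
apply: entropy_le_posdef => //.
move: sv; rewrite -lee_fin; apply: le_trans.
pose a (k i : 'I_(size F)) := s (p k) * tile_coef N F (p i) (p k).
under eq_integral => w _.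
  rewrite qfQ; under eq_bigr => k _.
    rewrite mxE mulr_sumr.
    under eq_bigr => i _ do rewrite !mxE tnth_map mulrCA mulrC -/(p i) -/(a k i).
    over.
  rewrite -sumEFin.
  over.
rewrite ge0_integral_sum//.
- rewrite [X in (_ <= X%:E)%E]sumF -sumEFin; apply: lee_sum => k _.
  rewrite (integral_sqr_lincomb X_cov) lee_fin -(tile_coef_energy N_gt0 K (pF k)).
  rewrite sumF [leRHS]mulr_sumr; apply: ler_sum => i _.
  rewrite sumF mulr_sumr; apply: ler_sum => j _.
  by rewrite /a le_eqVlt; apply/orP; left; apply/eqP; ring.
- move=> k; apply/measurable_EFinP; apply: measurable_funX.
  by apply: measurable_sum => i; exact: measurable_funM.
- by move=> k w _; rewrite lee_fin sqr_ge0.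
Qed.

End FieldEntropy.

(** * Entropy gained at the low frequencies *)

Section LowFrequencies.
Context {R : realType} {disp : measure_display} {T : measurableType disp}.
Variables (P : probability T R) (d : nat).
Variables (X : 'rV[int]_d -> {RV P >-> R}) (K : 'rV[int]_d -> R).
Hypothesis X_cov : forall i j, 'E_P[(X i : T -> R) \* X j]%E = (K (i - j))%:E.
Hypothesis X_density :
  forall F : {fset 'rV[int]_d}, has_joint_density P (field_restr X F).
Hypothesis K_l1 : summable [set: 'rV[int]_d] (EFin \o K).

(** With [N = q * m], residues below [m] give angles below [2 * pi / q]. Only one corner of the
    frequency cube is used, still a fraction [q ^ - d] of it. *)
Definition low_frequency N m (k : 'rV[int]_d) :=
  [forall c, ((k 0%R c %% N%:Z)%Z < m%:Z)%R].

Definition low_count N m (F : {fset 'rV[int]_d}) : nat :=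
  count (fun k => full_tile N F (tile_of N k) && low_frequency N m k) F.

(** Passing to residues changes the angle by full turns only and moves a low frequency to where
    [S_low] applies. *)
Lemma cos_angle_low N (k j : 'rV[int]_d) : (0 < N)%N ->
  cos (angle N (idot k j)) =
  cos (dot (\row_c angle N (k 0%R c %% N%:Z)%Z) (int_point j)) :> R.
Proof.
move=> N0.
have -> : idot k j = N%:Z * idot (tile_of N k) j +
    \sum_c (k 0%R c %% N%:Z)%Z * j 0 c.
  rewrite /idot mulr_sumr -big_split; apply: eq_bigr => c _ /=.
  by rewrite !mxE mulrA -mulrDl [N%:Z * _]mulrC -divz_eq.
have := @cisD R (angle N (N%:Z * idot (tile_of N k) j))
  (angle N (\sum_c (k 0%R c %% N%:Z)%Z * j 0 c)).
rewrite cis_angle_mulN// mul1r -angleD => -[-> _]; congr cos.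
rewrite /dot /angle rmorph_sum mulr_sumr; apply: eq_bigr => c _ /=.
by rewrite !mxE intrM mulrA.
Qed.

Variable q : nat.
Hypothesis S_low : forall theta : 'rV[R]_d,
  (forall c, 0 <= theta 0 c) -> (forall c, theta 0 c * q%:R < 2 * pi) ->
  real_sum (fun j => cos (dot theta (int_point j)) * K j) = 0.
Hypothesis q_gt0 : (0 < q)%N.

(** The tile size is fixed before [F], so for a given [e] the bound can be used along a whole family
    of domains. *)
Lemma entropy_low_count (e : R) : 0 < e ->
  exists2 m, (0 < m)%N & forall F : {fset 'rV[int]_d},
  (entropy P (field_restr X F) <=
   ((size F)%:R * (ln (2 * pi) / 2 + 2 + l1norm K) +
    (low_count (q * m) m F)%:R * (ln e / 2))%:E)%E.
Proof.
move=> e0; have [B uB Be] := l1norm_approx K_l1 e0.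
pose b := \max_(j <- B) \max_(c < d) `|j 0%R c|%N.
have Bb (j : 'rV[int]_d) c : j \in B -> (`|j 0%R c| <= b)%N.
  move=> jB; apply: leq_trans (_ : _ <= \max_(c < d) `|j 0%R c|%N)%N _.
    exact: (leq_bigmax_cond c).
  by rewrite /b; apply: (@leq_bigmax_seq _ B xpredT).
have n0 : 0 <= l1norm K by apply: le_trans (norm_K_le K_l1 0).
(* Makes the tile so large that its sites that are not deep add at most [e] to the average, as [Ne]
   records. *)
pose m := (Num.bound ((2 * b * d)%:R * l1norm K / e)).+1.
exists m => // F; set N := (q * m)%N.
have m0 : (0 < m)%N by [].
have N0 : (0 < N)%N by rewrite muln_gt0 q_gt0.
have Ne : (2 * b * d)%:R * l1norm K <= e * N%:R.
  rewrite [e * _]mulrC -ler_pdivrMr//.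
  have r0 : 0 <= (2 * b * d)%:R * l1norm K / e.
    by rewrite divr_ge0 ?mulr_ge0 ?ler0n// ltW.
  apply: le_trans (ltW (archi_boundP r0)) _.
  rewrite ler_nat; apply: leq_trans (leqnSn _) _.
  by rewrite /N leq_pmull.
pose A k := full_tile N F (tile_of N k) && low_frequency N m k.
(* Dividing a low frequency by [Num.sqrt e] brings its energy from [4 * e] down to 4 and adds
   [ln e / 2] to the entropy bound. *)
pose s k : R := if A k then (Num.sqrt e)^-1 else 1.
have s0 k : 0 < s k by rewrite /s; case: ifP => // _; rewrite invr_gt0 sqrtr_gt0.
have s2 k : s k ^+ 2 = if A k then e^-1 else 1.
  by rewrite /s; case: ifP; rewrite ?expr1n// exprVn sqr_sqrtr// ltW.
have psd := cov_psd X_cov.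
(* A low frequency costs at most 4, another frequency of a full tile at most [2 * l1norm K], an
   untransformed site at most [l1norm K]. *)
have vle : \sum_(k <- F) s k ^+ 2 * (if full_tile N F (tile_of N k) then
    tile_energy N K (tile_of N k) k else K 0) <= (size F)%:R * (4 + 2 * l1norm K).
  rewrite -sum1_size natr_sum mulr_suml; apply: ler_sum => k _; rewrite mul1r s2.
  have K0 : K 0 <= l1norm K := le_trans (ler_norm _) (norm_K_le K_l1 0).
  have E2 t : tile_energy N K t k <= 2 * l1norm K.
    exact: tile_energy_le_l1norm.
  case: ifPn => [/andP[-> klow]|_]; last first.
    by rewrite mul1r; case: ifP => _; [have := E2 (tile_of N k)|]; lra.
  suff : tile_energy N K (tile_of N k) k <= 4 * e.
    by move=> ?; rewrite mulrC ler_pdivrMr//; nra.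
  apply: (tile_energy_low N0 K_l1 psd _ _ uB Bb Be (ltW e0) Ne).
  under [fun j => _]funext => j do rewrite cos_angle_low//.
  have N0R : (0 : R) < N%:R by rewrite ltr0n.
  apply: S_low => c; rewrite mxE /angle.
    rewrite !mulr_ge0 ?pi_ge0 ?invr_ge0 ?ler0z ?ler0n//.
    by rewrite modz_ge0// eqz_nat -lt0n.
  have /forallP/(_ c) kc := klow.
  rewrite mulrAC -mulrA mulrAC ltr_pdivrMr//.
  rewrite ltr_pM2l ?mulr_gt0 ?pi_gt0// /N natrM ltr_pM2l ?ltr0n//.
  by rewrite -[m%:R]/(m%:Z%:~R) ltr_int.
apply: le_trans (entropy_field_le X_cov N0 (X_density F) s0 vle) _.
rewrite lee_fin.
have -> : \sum_(k <- F) ln (s k ^+ 2) = - ln e *+ low_count N m F.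
  rewrite /low_count -sum1_count -mulr_natr natr_sum mulr_sumr [RHS]big_mkcond.
  apply: eq_bigr => k _; rewrite s2 -/(A k); case: ifP => _; last by rewrite ln1.
  by rewrite lnV ?posrE// mulr1.
rewrite mulNrn opprK -(mulr_natl (ln (2 * pi))) -(mulr_natl (ln e)) le_eqVlt.
by apply/orP; left; apply/eqP; field.
Qed.

End LowFrequencies.

(** * Counting lattice points and low frequencies in the dilated domain *)

Section LatticeCount.
Context {R : realType}.
Variable d : nat.
Implicit Types (Lambda : set 'rV[R]_d) (L : R).

Lemma finite_lattice_points Lambda L : bounded_set Lambda -> 0 < L ->
  finite_set (lattice_points Lambda L).
Proof.
move=> /pinfty_ex_gt0[M M0 bM] L0.
have boundL x c : Lambda x -> `|x 0 c| < M + 1.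
  move=> /bM xM.
  have : ball (0 : 'rV[R]_d) (M + 1) x.
    by rewrite mx_norm_ball /ball_ /= sub0r normrN (le_lt_trans xM)// ltrDl.
  by case=> _ /(_ 0 c); rewrite mxE -ball_normE /= sub0r normrN.
pose B := (Num.truncn (L * (M + 1))).+1.
pose g (f : {ffun 'I_d -> 'I_(2 * B).+1}) : 'rV[int]_d :=
  \row_c ((f c)%:Z - B%:Z).
apply: (sub_finite_set _ (finite_image g (@finite_finset _ setT))).
move=> j [x Lx xj] /=.
have jB c : `|j 0 c| < B%:Z.
  rewrite -(ltr_int R) intr_norm; apply: (@lt_trans _ _ (L * (M + 1))); last first.
    by rewrite truncnS_gt.
  have /rowP/(_ c) := xj; rewrite !mxE => <-.
  by rewrite normrM gtr0_norm// ltr_pM2l// boundL.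
have lt2B c : (`|(j 0 c + B%:Z)%R|%N < (2 * B).+1)%N.
  by move: (jB c); set z := j 0 c; lia.
exists [ffun c => Ordinal (lt2B c)] => //.
apply/rowP => c; rewrite !mxE ffunE /=.
by move: (jB c); set z := j 0 c; lia.
Qed.

(** The dilated domain contains a cube of half-side [L * rho] about [L *: x0]. In it lie [p ^ d]
    full tiles with [m ^ d] low frequencies each, where [p] is at least [L * rho / (2 * N)]. *)
Lemma low_count_ge Lambda (x0 : 'rV[R]_d) (rho L : R) q m :
  bounded_set Lambda ->
  (forall y : 'rV[R]_d, (forall c, `|x0 0 c - y 0 c| < rho) -> Lambda y) ->
  0 < rho -> (0 < q)%N -> (0 < m)%N -> 0 < L -> 4 * (q * m)%:R <= L * rho ->
  (L * rho / (2 * q%:R)) ^+ d <=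
  (low_count (q * m) m (fset_set (lattice_points Lambda L)))%:R.
Proof.
move=> bL boxL rho0 q0 m0 L0; set N := (q * m)%N => LN.
have N0 : (0 < N)%N by rewrite muln_gt0 q0.
have N0R : (0 : R) < N%:R by rewrite ltr0n.
have finL := finite_lattice_points bL L0.
set F := fset_set _.
have boxF (j : 'rV[int]_d) :
    (forall c, `|L * x0 0 c - (j 0 c)%:~R| < L * rho) -> j \in F.
  move=> jL; rewrite in_fset_set// inE; exists (L^-1 *: int_point j).
    apply: boxL => c; rewrite !mxE.
    rewrite -(ltr_pM2l L0) -{1}(gtr0_norm L0) -normrM mulrBr mulVKf ?gt_eqF//.
  by rewrite scalerA mulfV ?gt_eqF// scale1r.
have y4 : 4 <= L * rho / N%:R by rewrite ler_pdivlMr.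
(* One tile is given up because [L *: x0] need not be a corner of the tiling. As the quotient is at
   least 4, [p] is still at least half of it. *)
pose p := (Num.truncn (L * rho / N%:R)).-1.
have y0 : 0 <= L * rho / N%:R by apply: le_trans y4.
have /andP[trl tru] := truncn_itv y0.
have pE : Num.truncn (L * rho / N%:R) = p.+1.
  by rewrite /p prednK// truncn_gt0; apply: le_trans y4; rewrite ler1n.
rewrite pE in trl tru.
have p_ge : L * rho / N%:R / 2 <= p%:R.
  by move: tru y4; rewrite -addn2 natrD; lra.
have p_le : N%:R * (p%:R + 1) <= L * rho.
  by rewrite natr1 -ler_pdivlMl// mulrC.
(* The first tile starting strictly to the right of the centre; the [p] tiles from there on fit in
   the right half of the cube. *)
pose a c : int := Num.floor (L * x0 0 c / N%:R) + 1.
have a_gt c : L * x0 0 c < N%:R * (a c)%:~R.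
  by rewrite -ltr_pdivrMl// mulrC floorD1_gt.
have a_le c : N%:R * (a c)%:~R <= L * x0 0 c + N%:R.
  rewrite /a intrD mulrDr mulr1 lerD2r -ler_pdivlMl// mulrC.
  exact: floor_le.
have lt_mN (r : 'I_m) : (r < N)%N.
  by apply: leq_trans (ltn_ord r) _; rewrite /N leq_pmull.
pose t (f : {ffun 'I_d -> 'I_p * 'I_m}) : 'rV[int]_d := \row_c (a c + (f c).1%:Z).
pose g f := tile_site (t f) [ffun c => Ordinal (lt_mN (f c).2)].
have tile_in f r : @tile_site d N (t f) r \in F.
  apply: boxF => c; rewrite !mxE intrD intrM intrD.
  have rN : ((r c)%:Z%:~R : R) + 1 <= N%:R by rewrite natr1 ler_nat ltn_ord.
  have fp : ((f c).1%:Z%:~R : R) + 1 <= p%:R by rewrite natr1 ler_nat ltn_ord.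
  have r0 : 0 <= ((r c)%:Z%:~R : R) by rewrite ler0n.
  have f0 : 0 <= ((f c).1%:Z%:~R : R) by rewrite ler0n.
  have := a_gt c; have := a_le c; have := p_le.
  move: rN fp r0 f0; rewrite -[N%:Z%:~R]/(N%:R : R).
  move: (_%:~R) (_%:~R) ((a c)%:~R : R) => u w z.
  by rewrite ltr_norml => *; apply/andP; split; nra.
have g_inj : injective g.
  move=> f f' gf; have tg h : tile_of N (g h) = t h by exact: tile_of_site.
  have tf : t f = t f' by rewrite -!tg gf.
  have rf : [ffun c => Ordinal (lt_mN (f c).2)] = [ffun c => Ordinal (lt_mN (f' c).2)].
    by apply: (@tile_site_inj d N (t f')); rewrite -{1}tf; exact: gf.
  apply/ffunP => c; rewrite [f c]surjective_pairing [f' c]surjective_pairing.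
  congr pair; apply: val_inj.
    by have /rowP/(_ c) := tf; rewrite !mxE => /addrI[].
  by have /ffunP/(_ c) := rf; rewrite !ffunE => -[].
apply: (@le_trans _ _ ((p * m) ^ d)%:R).
  rewrite natrX lerXn2r ?nnegrE ?divr_ge0 ?mulr_ge0 ?ler0n ?(ltW L0) ?(ltW rho0)//.
  rewrite natrM; apply: le_trans (_ : L * rho / N%:R / 2 * m%:R <= _); last first.
    by rewrite ler_wpM2r.
  rewrite /N natrM le_eqVlt; apply/orP; left; apply/eqP; field.
  by rewrite !pnatr_eq0 -!lt0n q0 m0.
rewrite ler_nat /low_count -size_filter.
have -> : ((p * m) ^ d)%N = size [seq g f | f : {ffun 'I_d -> 'I_p * 'I_m}].
  by rewrite size_map -cardE card_ffun card_prod !card_ord.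
apply: uniq_leq_size; first by rewrite map_inj_uniq ?enum_uniq.
move=> _ /mapP[f _ ->]; rewrite seq.mem_filter /g tile_of_site// tile_in andbT.
apply/andP; split; first by apply/forallP => r; exact: tile_in.
apply/forallP => c; rewrite !mxE ffunE mulrC modzMDl modz_small/= ?ltz_nat//.
Qed.

End LatticeCount.

(** * Choice of the parameters and passage to the limit *)

Theorem theorem7 (R : realType) (d : nat) (hd : (0 < d)%N)
  (disp : measure_display) (T : measurableType disp) (P : probability T R)
  (X : 'rV[int]_d -> {RV P >-> R}) (K : 'rV[int]_d -> R)
  (X_mean : forall i, 'E_P[X i]%E = 0%E)
  (X_var : forall i, 'V_P[X i]%E = 1%E)
  (X_cov : forall i j, 'E_P[(X i : T -> R) \* X j]%E = (K (i - j))%:E)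
  (X_inv : translation_invariant P X)
  (X_density : forall F : {fset 'rV[int]_d}, has_joint_density P (field_restr X F))
  (K_l1 : summable [set: 'rV[int]_d] (EFin \o K))
  (Lambda : set 'rV[R]_d)
  (Lambda_domain : bounded_domain Lambda)
  (Lambda_smooth : two_smooth (boundary Lambda))
  (Lambda_curv : components_positive_curvature (boundary Lambda))
  (Lambda_count : exists C : R, \forall L \near +oo%R,
     (#|` fset_set (lattice_points Lambda L)|%:R : R) <= C * L ^+ d)
  (S_vanish : \forall theta \near (0 : 'rV[R]_d), structure_function K theta = 0)
  (S_l1 : (\esum_(j in [set: 'rV[int]_d])
     (Normc.normc (fourier_coef (structure_function K) j))%:E < +oo)%E)
  (S_h12 : (\esum_(j in [set: 'rV[int]_d])
     ((enorm (@int_point R d j) *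
       Normc.normc (fourier_coef (structure_function K) j)) ^+ 2)%:E < +oo)%E) :
  (fun L : R =>
     let F := fset_set (lattice_points Lambda L) in
     entropy P (field_restr X F) * (#|` F|%:R^-1)%:E)%E @ +oo%R --> -oo%E.
Proof.
move/nbhs_ballP : S_vanish => [delta /= delta0 S0].
(* Chosen so that [2 * pi / q < delta]: the box in [S_low] then lies where the structure function
   vanishes. *)
pose q := (Num.truncn (2 * pi / delta)).+1.
have q0 : (0 < q)%N by [].
have S_low (theta : 'rV[R]_d) :
    (forall c, 0 <= theta 0 c) -> (forall c, theta 0 c * q%:R < 2 * pi) ->
    real_sum (fun j => cos (dot theta (int_point j)) * K j) = 0.
  move=> theta0 thetaq; have : structure_function K theta = 0.
    apply: S0; split=> // i c; rewrite ord1 mxE -ball_normE /= sub0r normrN.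
    rewrite ger0_norm//; have := thetaq c; have := truncnS_gt (2 * pi / delta).
    rewrite -/q ltr_pdivrMr// => pq tq.
    have q0R : (0 : R) < q%:R by rewrite ltr0n.
    by rewrite -(ltr_pM2r q0R) (lt_trans tq)// [ltRHS]mulrC.
  move=> /(congr1 (@complex.Re R)) /= <-; congr real_sum; apply/funext => j.
  by rewrite mulr0 subr0.
have [[x0 Lx0] Lopen _ Lbd] := Lambda_domain.
have /nbhs_ballP[rho /= rho0 boxL] : nbhs x0 Lambda by apply: open_nbhs_nbhs.
have {}boxL (y : 'rV[R]_d) : (forall c, `|x0 0 c - y 0 c| < rho) -> Lambda y.
  by move=> xy; apply: boxL; split=> // i c; rewrite ord1 -ball_normE; exact: xy.
have [C countC] := Lambda_count.
set a := ln (2 * pi) / 2 + 2 + l1norm K : R.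
pose c := (rho / (2 * q%:R)) ^+ d.
have c0 : 0 < c by rewrite exprn_gt0// divr_gt0// mulr_gt0// ltr0n.
apply/cvgeNyPle => A.
(* There are at least [c * L ^+ d] low frequencies and at most [C * L ^+ d] sites, so [D] times the
   former is at least [|A| + |a|] times the latter. With [e = expR (- (2 * D))] each low frequency
   contributes [ln e / 2 = - D]. *)
pose D := Num.max C 0 / c * (`|A| + `|a|).
have [m m0 entm] := entropy_low_count X_cov X_density K_l1 S_low q0
  (expR_gt0 (- (2 * D))).
near=> L.
have nC : (#|` fset_set (lattice_points Lambda L)|%:R : R) <= C * L ^+ d.
  by near: L; exact: countC.
set F := fset_set (lattice_points Lambda L) in nC *.
have L0 : 0 < L by near: L; exact: nbhs_pinfty_gt.
have LN : 4 * (q * m)%:R <= L * rho.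
  by rewrite -ler_pdivrMr//; near: L; exact: nbhs_pinfty_ge.
have Gge : c * L ^+ d <= (low_count (q * m) m F)%:R.
  by have := low_count_ge Lbd boxL rho0 q0 m0 L0 LN; rewrite -mulrA exprMn mulrC.
have Gn : (low_count (q * m) m F)%:R <= (size F)%:R :> R by rewrite ler_nat count_size.
have Ld0 : 0 < L ^+ d by rewrite exprn_gt0.
(* For large [L] there are low frequencies, so [F] is nonempty and the normalisation is a genuine
   division. *)
have n0 : 0 < (size F)%:R :> R.
  by apply: lt_le_trans Gn; apply: lt_le_trans Gge; rewrite mulr_gt0.
rewrite lee_pdivrMr//; apply: le_trans (entm F) _; rewrite lee_fin -/a expRK.
have D0 : 0 <= D by rewrite !mulr_ge0 ?invr_ge0 ?(ltW c0)// le_max lexx orbT.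
have : (size F)%:R * (`|A| + `|a|) <= D * (low_count (q * m) m F)%:R.
  apply: (@le_trans _ _ (D * (c * L ^+ d))); last by rewrite ler_wpM2l.
  have -> : D * (c * L ^+ d) = Num.max C 0 * L ^+ d * (`|A| + `|a|).
    by rewrite /D; field; rewrite gt_eqF.
  rewrite ler_wpM2r// (le_trans nC)// ler_wpM2r ?(ltW Ld0)//.
  by rewrite le_max lexx.
have : (size F)%:R * a <= (size F)%:R * `|a| by rewrite ler_wpM2l ?(ltW n0)// ler_norm.
have : - (size F)%:R * `|A| <= (size F)%:R * A.
  by rewrite mulNr -mulrN ler_wpM2l ?(ltW n0)// lerNl (le_trans (ler_norm _))// normrN.
by move: (low_count _ _ _)%:R => G; lra.
Unshelve. all: by end_near.
Qed.
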